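(* Let $F_1$ be the distribution function of the degenerate distribution at the origin. Let $F_2$ be the distribution function of an absolutely continuous distribution on $\mathbb{R}$ with density $f_2$ satisfying $$ f_2(x) = \begin{cases} \int_{|x|}^{\infty} v_1(y)\,dy & \text{if } x<0,\\ \int_{x}^{\infty} v_2(y)\,dy & \text{if } x>0, \end{cases} $$ where $v_1$ and $v_2$ are (nonnegative) log-convex functions on $(0,\infty)$. For each $\alpha\in[0,1]$, let $F^{(\alpha)}$ be the distribution function given by $$ F^{(\alpha)}(x) = \alpha F_1(x) + (1-\alpha)F_2(x),\qquad x\in\mathbb{R}. $$ Then, for each $\alpha\in[0,1]$, $F^{(\alpha)}$ is infinitely divisible.
   Context: A function $g:(0,\infty)\to[0,\infty)$ is called log-convex (on $(0,\infty)$) if $g^2(x+y)\le g(x)\,g(x+2y)$ for all $x\in(0,\infty)$ and all $y\in(0,1)$ (the identically zero function is allowed). A distribution function $F$ on $\mathbb{R}$ is infinitely divisible if for every positive integer $n$ there is a distribution function $F_n$ on $\mathbb{R}$ whose $n$-fold convolution with itself equals $F$. *)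

(* Defs.v *)
From HB Require Import structures.
From mathcomp Require Import all_boot all_order all_algebra.
From mathcomp Require Import all_classical all_reals all_analysis.
Set Implicit Arguments.
Unset Strict Implicit.
Unset Printing Implicit Defensive.
Import Order.TTheory GRing.Theory Num.Theory.
Import numFieldNormedType.Exports.
Local Open Scope classical_set_scope.
Local Open Scope ring_scope.

(* Right-continuous nondecreasing functions with limits 0 at -oo and 1 at +oo. *)
Notation distribution_function R := (cumulativeBounded (0 : R) (1 : R)).

(* Functions (0, +oo) -> [0, +oo) are represented by total functions on R whose
   values outside (0, +oo) are irrelevant. *)
Definition log_convex (R : realType) (g : R -> R) : Prop :=
  (forall x, 0 < x -> 0 <= g x) /\
  (forall x y, 0 < x -> 0 < y < 1 ->
     g (x + y) ^+ 2 <= g x * g (x + 2 * y)).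

Definition is_distribution_function_of (R : realType)
    (P : set R -> \bar R) (F : R -> R) : Prop :=
  forall x, (F x)%:E = P `]-oo, x]%classic.

Definition is_density (R : realType) (F f : R -> R) : Prop :=
  [/\ measurable_fun [set: R] f,
      forall x, 0 <= f x &
      forall x, (F x)%:E =
        (\int[lebesgue_measure]_(t in `]-oo, x]) (f t)%:E)%E].

(* In the extended reals, so that [(f x)%:E = tail_integral v x] forces the
   integral to be finite. *)
Definition tail_integral (R : realType) (v : R -> R) (x : R) : \bar R :=
  (\int[lebesgue_measure]_(y in `[x, +oo[) (v y)%:E)%E.

(* (G * H)(x) = \int G (x - y) dH(y), a Lebesgue-Stieltjes integral. *)
Definition convolution (R : realType) (G : R -> R)
    (H : distribution_function R) : R -> R :=
  fun x => \int[lebesgue_stieltjes_measure H]_y G (x - y).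

(* F * ... * F with n factors; only meaningful for 0 < n. *)
Definition nfold_convolution (R : realType) (F : distribution_function R)
    (n : nat) : R -> R :=
  iter n.-1 (fun G => convolution G F) F.

(* The case n = 1 forces F to be a distribution function. *)
Definition infinitely_divisible (R : realType) (F : R -> R) : Prop :=
  forall n : nat, (0 < n)%N ->
    exists Fn : distribution_function R, nfold_convolution Fn n =1 F.

Definition mixture (R : realType) (alpha : R) (F1 F2 : R -> R) : R -> R :=
  fun x => alpha * F1 x + (1 - alpha) * F2 x.

(* Main.v *)
From HB Require Import structures.
Require Import Defs.
From mathcomp Require Import all_boot all_order all_algebra.
From mathcomp Require Import all_classical all_reals all_analysis.
From mathcomp Require Import measurable_realfun.
From mathcomp Require Import ring lra zify.
Import Order.TTheory GRing.Theory Num.Theory.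
Import numFieldNormedType.Exports.
Local Open Scope classical_set_scope.
Local Open Scope ring_scope.
Set Implicit Arguments.
Unset Strict Implicit.
Unset Printing Implicit Defensive.

(** Fix a mesh h and round the mixture towards 0: all the mass of (-h, h] goes to 0, that of
(kh, (k+1)h] to kh and that of (-(k+1)h, -kh] to -kh, for k >= 1.  Let p_n and q_n, n >= 0, be
the masses at nh and -nh.  For n >= 1 the difference p_n - p_(n+1) is, up to the factor
1 - alpha, the integral of v2(nh + r + s) over 0 < r, s < h, and log-convexity survives
integration over a parameter, because y^2 <= x z says that 2 y <= l x + z / l for every l > 0,
which is linear in (x, y, z).  So p_n - p_(n+1) is log-convex in n; the atom at 0 and the rounding
only increase the term n = 0, which does no harm.

Such a lattice law is the law of X - Y for independent X, Y on the natural numbers with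
log-convex masses ([wiener_hopf]).  The second difference of the law, up to sign and scale, is
delta_0 - S for the step law S of a centered random walk whose one-sided tails are
proportional to u_n = p_n - p_(n+1) and w_n = q_n - q_(n+1).  Factoring delta_0 - S through the
two ladder height laws and cancelling the differences leaves p_n = sum_k t_(n+k) tau_k, where t and tau are, up to
a factor, the tails of the ladder heights.  These satisfy
t_n = g u_n + sum_(k >= 1) t_(n+k) (tau_(k-1) - tau_k), so t is a positive combination of shifts of
u, and inherits log-convexity.

A log-convex sequence has convolution roots of every order ([kaluza_root]): its logarithmic
derivative has nonnegative coefficients.  Hence every law obtained by rounding has an n-th root.
When h tends to 0 the roots are tight, and a weak limit point of them is an n-th root of the
mixture ([lattice_approximation], [levy_limit]).

Convolution with a probability measure is handled as the operator f |-> (x |-> E f(x - Z)) on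
nonnegative measurable functions.  These operators commute by Tonelli's theorem, and the value at
x of an n-fold convolution is the n-th iterate on the indicator of [0, +oo), evaluated at x. *)

(** * Log-convex sequences *)

Section logconvex.
Context {R : realType}.
Implicit Types s t : nat -> R.

(** The right-hand side is linear in (x, y, z), so the family of inequalities, unlike the quadratic
one, can be summed, integrated and passed to the limit. *)
Lemma sqr_le_mul_amgm (x y z : R) : 0 <= x -> 0 <= y -> 0 <= z ->
  (y ^+ 2 <= x * z) <-> (forall l, 0 < l -> 2 * y <= l * x + l^-1 * z).
Proof.
move=> x0 y0 z0; split.
  move=> yxz l l0.
  have li0 : 0 < l^-1 by rewrite invr_gt0.
  have lx0 : 0 <= l * x by apply: mulr_ge0 => //; exact: ltW.
  have lz0 : 0 <= l^-1 * z by apply: mulr_ge0 => //; exact: ltW.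
  rewrite -(@ler_pXn2r _ 2)// ?nnegrE ?mulr_ge0 ?addr_ge0//.
  have : (l * x) * (l^-1 * z) = x * z by field; rewrite gt_eqF.
  by have := sqr_ge0 (l * x - l^-1 * z); nra.
move=> H; have [->|yn0] := eqVneq y 0; first by rewrite expr0n mulr_ge0.
have {}y0 : 0 < y by rewrite lt_def yn0.
have [xE|xn0] := eqVneq x 0.
  have l0 : 0 < (z + 1) / y by rewrite divr_gt0// ltr_pwDr.
  have := H _ l0; rewrite xE mulr0 add0r invf_div => H1.
  have z1 : 0 < z + 1 by rewrite ltr_pwDr.
  have : y / (z + 1) * z <= y.
    by rewrite mulrAC ler_pdivrMr// ler_wpM2l ?ltW// ltrDl.
  by move: y0; lra.
have {}x0 : 0 < x by rewrite lt_def xn0.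
have := H _ (divr_gt0 y0 x0); rewrite divfK ?gt_eqF// invf_div => H1.
have : y <= x / y * z by lra.
by rewrite mulrAC ler_pdivlMr.
Qed.

Definition logconvex s :=
  (forall n, 0 <= s n) /\ (forall n, s n.+1 ^+ 2 <= s n * s n.+2).

Lemma logconvexP s : logconvex s <-> (forall n, 0 <= s n) /\
  (forall l n, 0 < l -> 2 * s n.+1 <= l * s n + l^-1 * s n.+2).
Proof.
split=> -[s0 H]; split=> //.
  move=> l n l0; exact: (sqr_le_mul_amgm (s0 n) (s0 n.+1) (s0 n.+2)).1.
by move=> n; apply/(sqr_le_mul_amgm (s0 n) (s0 n.+1) (s0 n.+2)) => l /H.
Qed.

Lemma logconvexD s t : logconvex s -> logconvex t ->
  logconvex (fun n => s n + t n).
Proof.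
move=> /logconvexP[s0 Hs] /logconvexP[t0 Ht]; apply/logconvexP; split=> [n|l n l0].
  exact: addr_ge0.
by have := lerD (Hs l n l0) (Ht l n l0); rewrite !mulrDr; lra.
Qed.

Lemma logconvexZ c s : 0 <= c -> logconvex s -> logconvex (fun n => c * s n).
Proof.
move=> c0 [s0 Hs]; split=> n; first exact: mulr_ge0.
by have := ler_wpM2l (sqr_ge0 c) (Hs n); rewrite exprMn expr2; lra.
Qed.

Lemma logconvex_shift k s : logconvex s -> logconvex (fun n => s (n + k)%N).
Proof. by move=> [s0 Hs]; split=> n; rewrite ?addSn. Qed.

Lemma logconvex_sum (f : nat -> nat -> R) m :
  (forall k, logconvex (f k)) -> logconvex (fun n => \sum_(k < m) f k n).
Proof.
move=> Hf; elim: m => [|m IH].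
  split=> n; first by rewrite big_ord0.
  by rewrite !big_ord0 expr0n mul0r.
have := logconvexD IH (Hf m); congr logconvex.
by apply/funext => n; rewrite big_ord_recr.
Qed.

Lemma logconvex_lim (f : nat -> nat -> R) s : (forall j, logconvex (f j)) ->
  (forall n, (fun j => f j n) @ \oo --> s n) -> logconvex s.
Proof.
move=> Hf fs; split=> n.
  apply: (cvgr_to_ge (fs n)); near=> j; exact: (Hf j).1.
apply: ler_cvg_to (cvgM (fs n.+1) (fs n.+1)) (cvgM (fs n) (fs n.+2)) _.
by near=> j; rewrite /= -expr2; exact: (Hf j).2.
Unshelve. all: by end_near. Qed.

Lemma cvg0_nonincreasing_ge0 s : nonincreasing_seq s -> s @ \oo --> (0 : R) ->
  forall n, 0 <= s n.
Proof.
move=> sd s0 n; rewrite -(cvg_lim _ s0)//.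
exact: nonincreasing_cvgn_ge sd (cvgP _ s0) n.
Qed.

Lemma nonincreasing_seqS s : (forall n, s n.+1 <= s n) -> nonincreasing_seq s.
Proof. by move=> H; apply/nonincreasing_seqP. Qed.

(** With l = 1 the inequality of arithmetic and geometric means turns log-convexity into convexity,
and a convex sequence that tends to 0 decreases. *)
Lemma logconvex_nonincreasing s : logconvex s -> s @ \oo --> (0 : R) ->
  nonincreasing_seq s.
Proof.
move=> /logconvexP[s0 Hs] s_0; apply: nonincreasing_seqS => n; rewrite -subr_ge0.
apply: (@cvg0_nonincreasing_ge0 (fun n => s n - s n.+1)).
  by apply: nonincreasing_seqS => k; have := Hs 1 k ltr01; rewrite invr1; lra.
rewrite -[0]subr0; apply: cvgB => //.
by rewrite cvg_shiftS.
Qed.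

(** A vanishing factor in s_n s_(n+2) kills s_(n+1): zeros propagate upwards, and downwards as far
as index 1. *)
Lemma logconvex_eq0 s : logconvex s -> forall m, s m.+1 = 0 -> forall n, s n.+1 = 0.
Proof.
move=> [s0 Hs] m sm.
have up i : s (m + i).+1 = 0.
  elim: i => [|i IH]; first by rewrite addn0.
  have := Hs (m + i).+1; rewrite IH mul0r addnS => H.
  by apply/eqP; rewrite -sqrf_eq0 eq_le H sqr_ge0.
have down i : (i <= m)%N -> s (m - i).+1 = 0.
  elim: i => [|i IH] im; first by rewrite subn0.
  have e : (m - i.+1).+1 = (m - i)%N by lia.
  have := Hs (m - i.+1)%N; rewrite e IH ?mulr0 1?ltnW// => H.
  by apply/eqP; rewrite -sqrf_eq0 eq_le H sqr_ge0.
move=> n; have [mn|/ltnW nm] := leqP m n.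
  by rewrite -(subnKC mn) up.
by have := down (m - n)%N (leq_subr _ _); rewrite subKn.
Qed.

(** The ratios s_(i+1) / s_i increase; the products avoid dividing by a vanishing term. *)
Lemma logconvex_ratio s : logconvex s ->
  forall i m, (i <= m)%N -> s i.+1 * s m <= s m.+1 * s i.
Proof.
move=> lcs i m im; have [s0 Hs] := lcs.
have [[k sk]|nz] := pselect (exists k, s k.+1 = 0).
  by rewrite (logconvex_eq0 lcs sk) mul0r mulr_ge0.
have sp n : 0 < s n.+1.
  by rewrite lt_def s0 andbT; apply/eqP => sn; apply: nz; exists n.
have s0p : 0 < s 0.
  rewrite lt_def s0 andbT; apply/eqP => s00; have := Hs 0.
  by rewrite s00 mul0r leNgt exprn_gt0.
have {}sp n : 0 < s n by case: n.
rewrite -(subnKC im); elim: (m - i)%N => [|d IH]; first by rewrite addn0 mulrC.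
rewrite addnS -(ler_pM2r (sp (i + d)%N)).
have := ler_wpM2r (s0 (i + d).+1) IH.
have := ler_wpM2r (s0 i) (Hs (i + d)%N).
by rewrite expr2; lra.
Qed.

End logconvex.

(** * Convolution roots of log-convex sequences *)

Section roots.
Context {R : realType}.
Implicit Types a b t : nat -> R.

Definition seqconv a b (m : nat) : R := \sum_(i < m.+1) a i * b (m - i)%N.

Definition seqpow a n : nat -> R := iter n (seqconv a) (fun m => (m == 0%N)%:R).

(** Recursion on the whole past of a real sequence, phrased so that the step may mention the entire
sequence as long as it only depends on the past. *)
Lemma course_of_values (step : nat -> (nat -> R) -> R) (c : R) :
  (forall m x y, (forall i, (i <= m)%N -> x i = y i) -> step m x = step m y) ->
  exists x : nat -> R, x 0%N = c /\ forall m, x m.+1 = step m x.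
Proof.
move=> Hstep.
pose F := fix F m : nat -> R := if m is k.+1 then
  fun i => if i == k.+1 then step k (F k) else F k i else fun=> c.
have FE m i : (i <= m)%N -> F m i = F i i.
  elim: m => [|m IH]; first by rewrite leqn0 => /eqP ->.
  rewrite leq_eqVlt => /orP[/eqP -> //|im].
  by rewrite /= ltn_eqF//= IH.
exists (fun m => F m m); split=> // m /=.
by rewrite eqxx; apply: Hstep => i; exact: FE.
Qed.

Lemma seqconv_recursion a b (c : R) : (forall m, b m != 0) ->
  exists x : nat -> R, x 0%N = c /\
    forall m, b m * x m.+1 = \sum_(i < m.+1) a i * x (m - i)%N.
Proof.
move=> b0.
have [|x [x0 Hx]] := @course_of_values
  (fun m x => (\sum_(i < m.+1) a i * x (m - i)%N) / b m) c.
  by move=> m x y xy; congr (_ / _); apply: eq_bigr => i _; rewrite xy ?leq_subr.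
by exists x; split => // m; rewrite Hx mulrC divfK.
Qed.

(** k is the coefficient sequence of T'/T, where T is the generating function of t.  Its next term
is (m+2) t_(m+2) - sum_i k_i t_(m+1-i) over t_0, and replacing each t_(m+1-i) by the larger
(t_(m+2) / t_(m+1)) t_(m-i) turns the sum into (m+1) t_(m+2); what remains is at least t_(m+2). *)
Lemma kaluza_logderiv t : logconvex t -> 0 < t 0%N ->
  exists k : nat -> R, (forall m, 0 <= k m) /\
    forall m, m.+1%:R * t m.+1 = seqconv k t m.
Proof.
move=> tlc t0.
have [|k [k0 Hk]] := @course_of_values (fun m k =>
  (m.+2%:R * t m.+2 - \sum_(i < m.+1) k i * t (m.+1 - i)%N) / t 0%N) (t 1%N / t 0%N).
  move=> m x y xy; congr (_ / _); congr (_ - _); apply: eq_bigr => i _.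
  by rewrite xy// -ltnS.
have E m : m.+1%:R * t m.+1 = seqconv k t m.
  case: m => [|m]; rewrite /seqconv.
    by rewrite big_ord1 k0 subn0 divfK ?gt_eqF// mul1r.
  by rewrite big_ord_recr/= subnn Hk divfK ?gt_eqF// addrC subrK.
exists k; split => // m.
have [tge0 _] := tlc.
elim/ltn_ind: m => -[_|m IH]; first by rewrite k0 divr_ge0 ?(ltW t0).
rewrite Hk divr_ge0 ?(ltW t0)// subr_ge0.
apply: (@le_trans _ _ (m.+1%:R * t m.+2)); last first.
  by rewrite ler_wpM2r// ler_nat.
have [tm|tm] := eqVneq (t m.+1) 0.
  rewrite big1 ?mulr_ge0// => i _.
  have im : (i <= m)%N by rewrite -ltnS.
  by rewrite subSn// (logconvex_eq0 tlc tm) mulr0.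
have {}tm : 0 < t m.+1 by rewrite lt_def tm tge0.
rewrite -(ler_pM2r tm) mulrAC E /seqconv !mulr_suml; apply: ler_sum => i _.
have im : (i <= m)%N by rewrite -ltnS.
rewrite -!mulrA ler_wpM2l ?IH// [leRHS]mulrC subSn//.
by apply: logconvex_ratio => //; rewrite (leq_trans (leq_subr _ _)).
Qed.

Lemma coefM_congr (M : nat) (s p q : {poly R}) : (forall i, (i < M)%N -> p`_i = q`_i) ->
  forall i, (i < M)%N -> (s * p)`_i = (s * q)`_i.
Proof.
move=> pq i iM; rewrite !coefM; apply: eq_bigr => j _.
by rewrite pq// (leq_ltn_trans (leq_subr _ _)).
Qed.

Lemma seqpow_coef a n N i : (i < N)%N ->
  seqpow a n i = ((\poly_(j < N) a j) ^+ n)`_i.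
Proof.
elim: n i => [|n IH] i iN; first by rewrite expr0 coef1.
rewrite exprS coefM /seqpow iterS; apply: eq_bigr => j _.
have jN : (j < N)%N by rewrite (leq_ltn_trans _ iN)// -ltnS.
by rewrite -/(seqpow a n) coef_poly jN IH// (leq_ltn_trans (leq_subr _ _)).
Qed.

(** The root is built with T'/(nT) as logarithmic derivative, whose coefficients are nonnegative.
Its n-th power then solves the same first-order recursion as t, with the same head. *)
Lemma kaluza_root t n : logconvex t -> 0 < t 0%N ->
  exists2 r : nat -> R, (forall m, 0 <= r m) & seqpow r n.+1 =1 t.
Proof.
move=> tlc t0.
have [k [k0 Hk]] := kaluza_logderiv tlc t0.
(* The head of the root is the real root of the head of t. *)
pose c := expR (ln (t 0%N) / n.+1%:R).
have [|r [r0 Hr]] := @seqconv_recursion k (fun m => n.+1%:R * m.+1%:R) c.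
  by move=> m; rewrite mulf_neq0// pnatr_eq0.
have cn : c ^+ n.+1 = t 0%N.
  by rewrite /c -expRM_natl mulrC divfK ?pnatr_eq0// lnK.
exists r.
  elim/ltn_ind => -[_|m IH]; first by rewrite r0 expR_ge0.
  have nm : 0 < n.+1%:R * m.+1%:R :> R by rewrite mulr_gt0.
  rewrite -(ler_pM2l nm) mulr0 Hr sumr_ge0// => i _.
  by rewrite mulr_ge0// IH// ltnS leq_subr.
move=> m; rewrite (seqpow_coef _ _ (ltnSn m)).
set P := \poly_(j < m.+1) r j; pose K := \poly_(j < m.+1) k j.
have PK i : (i < m)%N -> (P^`() *+ n.+1)`_i = (K * P)`_i.
  move=> im; rewrite coefMn coef_deriv coef_poly ltnS im.
  rewrite -[LHS]mulr_natl -[r _ *+ _]mulr_natl mulrA Hr coefM; apply: eq_bigr => j _.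
  have jm : (j < m.+1)%N by rewrite (leq_ltn_trans _ (ltn_trans im (ltnSn m)))// -ltnS.
  by rewrite !coef_poly jm (leq_ltn_trans (leq_subr _ _))// ltnW.
have PnK i : (i < m)%N -> ((P ^+ n.+1)^`())`_i = (K * P ^+ n.+1)`_i.
  move=> im; rewrite deriv_exp/= -mulrnAl mulrC.
  by rewrite (coefM_congr _ PK)// mulrCA -exprSr.
suff : forall i, (i <= m)%N -> (P ^+ n.+1)`_i = t i by exact.
elim/ltn_ind => -[_ _|i IH im].
  by rewrite -horner_coef0 horner_exp horner_coef0 coef_poly r0 cn.
have i0 : i.+1%:R != 0 :> R by rewrite pnatr_eq0.
apply: (mulfI i0); rewrite mulr_natl -coef_deriv PnK// Hk coefM.
apply: eq_bigr => j _; rewrite coef_poly IH ?ltnS ?leq_subr//.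
  by rewrite ltnW ?ltnS// (leq_trans _ im)// -ltnS.
by rewrite (leq_trans (leq_subr _ _))// ltnW.
Qed.
End roots.

(** * Wiener-Hopf factorization *)

Section wiener_hopf.
Context {R : realType}.
Implicit Types t tau u w p q : nat -> R.

Lemma cvg_sum_ord (m : nat) (f : nat -> nat -> R) (l : nat -> R) :
  (forall k, f k @ \oo --> l k) ->
  (fun j => \sum_(k < m) f k j) @ \oo --> \sum_(k < m) l k.
Proof.
move=> fl; elim: m => [|m IH].
  by under eq_fun do rewrite big_ord0; rewrite big_ord0; exact: cvg_cst.
under eq_fun do rewrite big_ord_recr; rewrite big_ord_recr/=.
exact: cvgD.
Qed.

Definition decr t (n : nat) : R := t n - t n.+1.

Lemma decr_ge0 t : nonincreasing_seq t -> forall n, 0 <= decr t n.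
Proof. by move=> td n; rewrite subr_ge0 td. Qed.

Lemma decr_le_cvg0 s t : s @ \oo --> (0 : R) -> t @ \oo --> (0 : R) ->
  (forall n, decr s n <= decr t n) -> forall n, s n <= t n.
Proof.
move=> s0 t0 st n; rewrite -subr_ge0.
apply: (@cvg0_nonincreasing_ge0 _ (fun n => t n - s n)).
  by apply: nonincreasing_seqS => k; have := st k; rewrite /decr; lra.
by rewrite -[0]subr0; apply: cvgB.
Qed.

Lemma cvg_shift0 t m : t @ \oo --> (0 : R) -> (fun n => t (n + m)%N) @ \oo --> (0 : R).
Proof. by move=> t0; rewrite cvg_shiftn. Qed.

Lemma cvg_shift0S t m : t @ \oo --> (0 : R) -> (fun n => t (n + m).+1) @ \oo --> (0 : R).
Proof.
move=> t0; have := cvg_shift0 m.+1 t0; apply: cvg_trans.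
by under [X in _ --> X @ _]eq_fun do rewrite addnS.
Qed.

(** Monotone convergence for series, in the form in which the number of terms grows with the stage. *)
Lemma cvg_diagonal_series (x : nat -> nat -> R) (y : nat -> R) (l : R) :
  (forall j k, 0 <= x j k) ->
  (forall k, nondecreasing_seq (x ^~ k)) ->
  (forall k, x ^~ k @ \oo --> y k) ->
  (fun j => \sum_(k < j) x j k) @ \oo --> l ->
  series y @ \oo --> l.
Proof.
move=> x0 xnd xy xl.
have xley j k : x j k <= y k.
  by rewrite -(cvg_lim _ (xy k))//; apply: nondecreasing_cvgn_le => //; exact: cvgP (xy k).
have y0 k : 0 <= y k by rewrite (le_trans (x0 0%N k)).
have syl N : series y N <= l.
  rewrite /series/= big_mkord.
  have := cvg_sum_ord (m := N) xy => H.
  apply: ler_cvg_to H xl _; near=> j.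
  have Nj : (N <= j)%N by near: j; exact: nbhs_infty_ge.
  rewrite -[leLHS](big_mkord xpredT (x j)) -[leRHS](big_mkord xpredT (x j)).
  rewrite [leRHS](big_cat_nat (n := N))//= lerDl.
  by apply: sumr_ge0.
apply: (squeeze_cvgr _ xl (cvg_cst l)).
near=> j; rewrite syl andbT /series/= big_mkord.
by apply: ler_sum.
Unshelve. all: by end_near. Qed.

(** The stages increase to the tail of the ascending ladder height of a walk whose step has tails
proportional to u on the right and w on the left; exchanging u and w gives the descending one.
The limit solves t_n = g u_n + sum_(k >= 1) t_(n+k) (tau_(k-1) - tau_k).  The sums stop at the
stage index, which keeps every stage a finite expression without spoiling monotonicity. *)
Fixpoint ladder u w (j : nat) : nat -> R :=
  if j is i.+1 then fun n =>
    (1 + \sum_(k < i) decr (ladder u w i) k * decr (ladder w u i) k)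
      / (u 0 + w 0) * u n
    + \sum_(k < i) ladder u w i (n + k).+1 * decr (ladder w u i) k
  else fun=> 0.

(** The factor g in front of u; its limit is the inverse of the constant of the factorization. *)
Definition gain u w j :=
  (1 + \sum_(k < j) decr (ladder u w j) k * decr (ladder w u j) k) / (u 0 + w 0).

Lemma gainC u w j : gain u w j = gain w u j.
Proof.
rewrite /gain (addrC (u 0)); congr ((1 + _) / _).
by apply: eq_bigr => k _; rewrite mulrC.
Qed.

Lemma ladderS u w j n : ladder u w j.+1 n =
  gain u w j * u n + \sum_(k < j) ladder u w j (n + k).+1 * decr (ladder w u j) k.
Proof. by []. Qed.

Lemma decr_ladderS u w j n : decr (ladder u w j.+1) n =
  gain u w j * decr u n +
  \sum_(k < j) decr (ladder u w j) (n + k).+1 * decr (ladder w u j) k.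
Proof.
rewrite /decr !ladderS opprD addrACA -mulrBr; congr (_ + _).
by rewrite -sumrB; apply: eq_bigr => k _; rewrite -mulrBl addSn.
Qed.

Definition ladder_data u w := [/\ logconvex u, u @ \oo --> (0 : R),
  logconvex w, w @ \oo --> (0 : R) & 0 < u 0 + w 0].

Lemma ladder_dataC u w : ladder_data u w -> ladder_data w u.
Proof. by case=> *; split => //; rewrite addrC. Qed.

(** Every stage is a finite nonnegative combination of shifts of u and of the previous stage. *)
Lemma ladder_lc_cvg j u w : ladder_data u w ->
  logconvex (ladder u w j) /\ ladder u w j @ \oo --> (0 : R).
Proof.
elim: j u w => [|j IH] u w d /=.
  split; last exact: cvg_cst.
  by split=> n //; rewrite expr0n mul0r.
have [tlc t0] := IH _ _ d.
have [slc s0] := IH _ _ (ladder_dataC d).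
have td := decr_ge0 (logconvex_nonincreasing tlc t0).
have sd := decr_ge0 (logconvex_nonincreasing slc s0).
have [ulc u0 _ _ uw0] := d.
split.
  apply: logconvexD.
    apply: logconvexZ ulc; apply: divr_ge0; last exact: ltW.
    by apply: addr_ge0 => //; apply: sumr_ge0 => k _; exact: mulr_ge0.
  apply: (@logconvex_sum _ (fun k n => ladder u w j (n + k).+1 * decr (ladder w u j) k)) => k.
  have := logconvexZ (sd k) (logconvex_shift k.+1 tlc).
  by congr logconvex; apply/funext => n; rewrite mulrC addnS.
have H1 : (fun n => gain u w j * u n) @ \oo --> gain u w j * 0 by exact: cvgMl_tmp.
have H2 : (fun n => \sum_(k < j) ladder u w j (n + k).+1 * decr (ladder w u j) k)
    @ \oo --> \sum_(k < j) 0 * decr (ladder w u j) k.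
  apply: (@cvg_sum_ord j (fun k n => ladder u w j (n + k).+1 * decr (ladder w u j) k)
    (fun k => 0 * decr (ladder w u j) k)) => k.
  exact: (cvgMr_tmp (cvg_shift0S k t0)).
have Z : \sum_(k < j) 0 * decr (ladder w u j) k = 0.
  by rewrite big1// => k _; exact: mul0r.
by have := cvgD H1 H2; rewrite mulr0 Z add0r; exact.
Qed.

Lemma ladder_ge0 j u w n : ladder_data u w -> 0 <= ladder u w j n.
Proof. by move=> /(ladder_lc_cvg j)[[]]. Qed.

Lemma ladder_decr_ge0 j u w n : ladder_data u w -> 0 <= decr (ladder u w j) n.
Proof.
by move=> /(ladder_lc_cvg j)[lc c0]; exact/decr_ge0/logconvex_nonincreasing.
Qed.

Lemma le_sum_ordS j (f g : nat -> R) : (forall k, f k <= g k) ->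
  0 <= g j -> \sum_(k < j) f k <= \sum_(k < j.+1) g k.
Proof.
by move=> fg g0; rewrite big_ord_recr/= ler_wpDr// ler_sum.
Qed.

(** The decrements are polynomials with nonnegative coefficients in the decrements of the previous
stages, so they increase with the stage; the stages themselves would not suffice, since the
recursion involves decrements. *)
Lemma ladder_decr_ndS j u w n : ladder_data u w ->
  decr (ladder u w j) n <= decr (ladder u w j.+1) n.
Proof.
elim: j u w n => [|j IH] u w n d.
  by rewrite [leLHS]subrr; exact: ladder_decr_ge0.
have d' := ladder_dataC d.
rewrite [leLHS]decr_ladderS [leRHS]decr_ladderS; apply: lerD.
  apply: ler_wpM2r.
    by have [ulc u0 _ _ _] := d; exact/decr_ge0/logconvex_nonincreasing.
  have [_ _ _ _ uw0] := d.
  rewrite ler_pM2r ?invr_gt0// lerD2l.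
  apply: (@le_sum_ordS j (fun k => decr (ladder u w j) k * decr (ladder w u j) k)
    (fun k => decr (ladder u w j.+1) k * decr (ladder w u j.+1) k)) => [k|].
    by apply: ler_pM; rewrite ?ladder_decr_ge0 ?IH.
  by rewrite mulr_ge0 ?ladder_decr_ge0.
apply: (@le_sum_ordS j (fun k => decr (ladder u w j) (n + k).+1 * decr (ladder w u j) k)
  (fun k => decr (ladder u w j.+1) (n + k).+1 * decr (ladder w u j.+1) k)) => [k|].
  by apply: ler_pM; rewrite ?ladder_decr_ge0 ?IH.
by rewrite mulr_ge0 ?ladder_decr_ge0.
Qed.

Lemma ladder_decr_nd u w n : ladder_data u w ->
  nondecreasing_seq (fun j => decr (ladder u w j) n).
Proof. by move=> d; apply/nondecreasing_seqP => j; exact: ladder_decr_ndS. Qed.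

Lemma ladder_nd u w n : ladder_data u w -> nondecreasing_seq (fun j => ladder u w j n).
Proof.
move=> d; apply/nondecreasing_seqP => j.
apply: decr_le_cvg0 => [||k]; [by case: (ladder_lc_cvg j d)|
  by case: (ladder_lc_cvg j.+1 d)|exact: ladder_decr_ndS].
Qed.

(** The choice of the gain is what makes the sums telescope. *)
Lemma ladder_sum u w j : ladder_data u w ->
  ladder u w j.+1 0 + ladder w u j.+1 0 =
  1 + ladder u w j 0 * ladder w u j 0 - ladder u w j j * ladder w u j j.
Proof.
move=> d; have [_ _ _ _ uw0] := d.
rewrite !ladderS -(gainC u w) addrACA -mulrDr divfK ?gt_eqF// -addrA -big_split/=.
rewrite -big_split/= -[in RHS]addrA; congr (_ + _).
have -> : forall a b : nat -> R, a 0%N * b 0%N - a j * b j =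
    \sum_(k < j) (a k * b k - a k.+1 * b k.+1).
  move=> a b; elim: j => [|m IH]; first by rewrite big_ord0 subrr.
  by rewrite big_ord_recr/= -IH; ring.
by apply: eq_bigr => k _; rewrite /decr !add0n; ring.
Qed.

(** The sum rule gives t'_0 + tau'_0 <= 1 + t_0 tau_0 <= 1 + t'_0 tau'_0 from one stage to the next,
that is (1 - t'_0) (1 - tau'_0) >= 0: both heads lie on the same side of 1, and their sum is at
most 2. *)
Lemma ladder_le1 u w j n : ladder_data u w -> ladder u w j n <= 1.
Proof.
move=> d; apply: (@le_trans _ _ (ladder u w j 0)).
  have [lc c0] := ladder_lc_cvg j d.
  exact: (logconvex_nonincreasing lc c0).
suff : ladder u w j 0 <= 1 /\ ladder w u j 0 <= 1 by case.
have d' := ladder_dataC d.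
elim: j => [|j [a1 b1]]; first by [].
have a0 := ladder_ge0 j 0 d; have b0 := ladder_ge0 j 0 d'.
have aa : ladder u w j 0 <= ladder u w j.+1 0 := ladder_nd 0 d (leqnSn j).
have bb : ladder w u j 0 <= ladder w u j.+1 0 := ladder_nd 0 d' (leqnSn j).
have E := ladder_sum j d.
have N := mulr_ge0 (ladder_ge0 j j d) (ladder_ge0 j j d').
move: (ladder u w j.+1 0) (ladder w u j.+1 0) aa bb E => a' b' aa bb E.
move: (ladder u w j 0) (ladder w u j 0) a0 b0 a1 b1 aa bb E => a b a0 b0 a1 b1 aa bb E.
have ab1 : a * b <= 1 by rewrite -[1]mulr1; apply: ler_pM.
have ab' : a * b <= a' * b' by apply: ler_pM.
have S : a' + b' <= 1 + a * b by move: N; rewrite E; lra.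
have H : 0 <= (1 - a') * (1 - b') by nra.
split; rewrite leNgt; apply/negP => h.
  have h1 : 0 < a' - 1 by lra.
  have h2 : 0 < 1 - b' by lra.
  by have := mulr_gt0 h1 h2; lra.
have h1 : 0 < b' - 1 by lra.
have h2 : 0 < 1 - a' by lra.
by have := mulr_gt0 h1 h2; lra.
Qed.

Definition ladder_lim u w (n : nat) : R := limn (fun j => ladder u w j n).

Lemma ladder_cvg u w n : ladder_data u w ->
  (fun j => ladder u w j n) @ \oo --> ladder_lim u w n.
Proof.
move=> d; apply: (nondecreasing_is_cvgn (ladder_nd n d)).
by exists 1 => _ [j _ <-]; exact: ladder_le1.
Qed.

Lemma ladder_le_lim u w j n : ladder_data u w ->
  ladder u w j n <= ladder_lim u w n.
Proof.
move=> d; apply: (nondecreasing_cvgn_le (ladder_nd n d)).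
exact: cvgP (ladder_cvg (n := n) d).
Qed.

Lemma decr_ladder_cvg u w n : ladder_data u w ->
  (fun j => decr (ladder u w j) n) @ \oo --> decr (ladder_lim u w) n.
Proof. by move=> d; apply: cvgB; exact: ladder_cvg. Qed.

Lemma ladder_lim_logconvex u w : ladder_data u w -> logconvex (ladder_lim u w).
Proof.
move=> d; apply: (@logconvex_lim _ (ladder u w)) => [j|n].
  by case: (ladder_lc_cvg j d).
exact: ladder_cvg.
Qed.

Lemma ladder_lim_ge0 u w n : ladder_data u w -> 0 <= ladder_lim u w n.
Proof. by move=> d; case: (ladder_lim_logconvex d). Qed.

Lemma ladder_lim_decr_ge0 u w n : ladder_data u w -> 0 <= decr (ladder_lim u w) n.
Proof.
move=> d; apply: (cvgr_to_ge (decr_ladder_cvg (n := n) d)).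
by near=> j; exact: ladder_decr_ge0.
Unshelve. all: by end_near. Qed.

Lemma ladder_lim_le1 u w n : ladder_data u w -> ladder_lim u w n <= 1.
Proof.
move=> d; apply: (cvgr_to_le (ladder_cvg (n := n) d)).
by near=> j; exact: ladder_le1.
Unshelve. all: by end_near. Qed.

Lemma ladder_lim_nonincreasing u w : ladder_data u w ->
  nonincreasing_seq (ladder_lim u w).
Proof.
move=> d; apply: nonincreasing_seqS => n; rewrite -subr_ge0.
exact: ladder_lim_decr_ge0.
Qed.

(** Each stage tends to 0 and has smaller decrements than the limit, hence it stays below the limit
by at least the value of the limit at infinity, which must therefore be 0. *)
Lemma ladder_lim_cvg0 u w : ladder_data u w -> ladder_lim u w @ \oo --> (0 : R).
Proof.
move=> d; set s := ladder_lim u w.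
have sc : cvgn s.
  apply: nonincreasing_is_cvgn; first exact: ladder_lim_nonincreasing.
  by exists 0 => _ [j _ <-]; exact: ladder_lim_ge0.
have L0 : 0 <= limn s by apply: limr_ge => //; near=> j; exact: ladder_lim_ge0.
suff L1 : limn s <= 0 by have <- : limn s = 0 by apply/eqP; rewrite eq_le L0 L1.
have key j : ladder u w j 0 <= s 0 - limn s.
  rewrite -subr_ge0.
  apply: (@cvg0_nonincreasing_ge0 _ (fun n => s n - limn s - ladder u w j n) _ _ 0).
    apply: nonincreasing_seqS => k.
    have : decr (ladder u w j) k <= decr s k.
      rewrite -(cvg_lim _ (decr_ladder_cvg (n := k) d))//.
      apply: (nondecreasing_cvgn_le (ladder_decr_nd k d)).
      exact: cvgP (decr_ladder_cvg (n := k) d).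
    by rewrite /decr; lra.
  have -> : 0 = limn s - limn s - 0 :> R by rewrite subrr subr0.
  apply: cvgB; last by case: (ladder_lc_cvg j d).
  by apply: cvgB => //; exact: cvg_cst.
have : s 0%N <= s 0%N - limn s.
  by apply: (cvgr_to_le (ladder_cvg (n := 0) d)); near=> j; exact: key.
by lra.
Unshelve. all: by end_near. Qed.

Section limit.
Variables (u w : nat -> R).
Hypothesis d : ladder_data u w.
Let d' := ladder_dataC d.
Let t := ladder_lim u w.
Let tau := ladder_lim w u.

Lemma gain_cvg : gain u w @ \oo --> limn (gain u w).
Proof.
apply: nondecreasing_is_cvgn.
  apply/nondecreasing_seqP => j; rewrite /gain.
  have [_ _ _ _ uw0] := d; rewrite ler_pM2r ?invr_gt0// lerD2l.
  apply: (@le_sum_ordS j (fun k => decr (ladder u w j) k * decr (ladder w u j) k)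
    (fun k => decr (ladder u w j.+1) k * decr (ladder w u j.+1) k)) => [k|].
    by apply: ler_pM; rewrite ?ladder_decr_ge0 ?ladder_decr_ndS.
  by rewrite mulr_ge0 ?ladder_decr_ge0.
have [_ _ _ _ uw0] := d.
exists (2 / (u 0%N + w 0%N)) => _ [j _ <-].
rewrite /gain ler_pM2r ?invr_gt0// -[2]/(1 + 1) lerD2l.
apply: (@le_trans _ _ (\sum_(k < j) decr (ladder u w j) k)).
  apply: ler_sum => k _; rewrite ler_piMr ?ladder_decr_ge0//.
  by have := ladder_le1 j k d'; have := ladder_ge0 j k.+1 d'; rewrite /decr; lra.
have -> : \sum_(k < j) decr (ladder u w j) k = ladder u w j 0 - ladder u w j j.
  have -> : forall (f : nat -> R) m, \sum_(k < m) decr f k = f 0%N - f m.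
    move=> f; elim=> [|m IH]; first by rewrite big_ord0 subrr.
    by rewrite big_ord_recr/= IH /decr; ring.
  by [].
by have := ladder_le1 j 0 d; have := ladder_ge0 j j d; lra.
Qed.

Lemma gain_lim_gt0 : 0 < limn (gain u w).
Proof.
have [_ _ _ _ uw0] := d.
apply: (@lt_le_trans _ _ ((u 0%N + w 0%N)^-1)); first by rewrite invr_gt0.
apply: (cvgr_to_ge gain_cvg); near=> j.
rewrite /gain ler_pMl ?invr_gt0// lerDl sumr_ge0// => k _.
by rewrite mulr_ge0 ?ladder_decr_ge0.
Unshelve. all: by end_near. Qed.

Lemma ladder_lim_eq n : series (fun k => t (n + k).+1 * decr tau k) @ \oo -->
  t n - limn (gain u w) * u n.
Proof.
apply: (@cvg_diagonal_series
    (fun j k => ladder u w j (n + k).+1 * decr (ladder w u j) k)).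
- by move=> j k; rewrite mulr_ge0 ?ladder_decr_ge0 ?ladder_ge0.
- move=> k i j ij; apply: ler_pM; rewrite ?ladder_decr_ge0 ?ladder_ge0//.
    exact: ladder_nd.
  exact: ladder_decr_nd.
- by move=> k; apply: cvgM; [exact: ladder_cvg|exact: decr_ladder_cvg].
have H : (fun j => ladder u w j.+1 n - gain u w j * u n) @ \oo -->
    t n - limn (gain u w) * u n.
  apply: cvgB; last exact: (cvgMr_tmp gain_cvg).
  by rewrite (cvg_shiftS (fun j => ladder u w j n)); exact: ladder_cvg.
rewrite (_ : (fun j => _) = fun j => ladder u w j.+1 n - gain u w j * u n)//.
by apply/funext => j; rewrite ladderS addrAC subrr add0r.
Qed.

(** The limit of the sum rule.  At least one of the two ladder heights is not defective. *)
Lemma ladder_lim_sum : (1 - t 0) * (1 - tau 0) = 0.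
Proof.
suff : t 0 + tau 0 = 1 + t 0 * tau 0 - 0 by move=> H; lra.
have H1 : (fun j => ladder u w j.+1 0 + ladder w u j.+1 0) @ \oo --> t 0 + tau 0.
  apply: cvgD.
    by rewrite (cvg_shiftS (fun j => ladder u w j 0)); exact: ladder_cvg.
  by rewrite (cvg_shiftS (fun j => ladder w u j 0)); exact: ladder_cvg.
have H3 : (fun j => ladder u w j j * ladder w u j j) @ \oo --> (0 : R).
  apply: (squeeze_cvgr _ (cvg_cst 0) (ladder_lim_cvg0 d)).
  near=> j; rewrite mulr_ge0 ?ladder_ge0//=.
  apply: le_trans (ladder_le_lim j j d).
  by rewrite ler_piMr ?ladder_ge0// ladder_le1.
have H2 : (fun j => 1 + ladder u w j 0 * ladder w u j 0 - ladder u w j j * ladder w u j j)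
    @ \oo --> 1 + t 0 * tau 0 - 0.
  apply: cvgB => //; apply: cvgD; first exact: cvg_cst.
  by apply: cvgM; exact: ladder_cvg.
have E : (fun j => ladder u w j.+1 0 + ladder w u j.+1 0) =
  (fun j => 1 + ladder u w j 0 * ladder w u j 0 - ladder u w j j * ladder w u j j).
  by apply/funext => j; rewrite ladder_sum.
by rewrite -E in H2; exact: (cvg_unique _ H1 H2).
Unshelve. all: by end_near. Qed.

End limit.

Section corr.
Variables (u w p : nat -> R).
Hypotheses (d : ladder_data u w) (p0 : p @ \oo --> (0 : R)) (pu : forall n, decr p n = u n).
Let t := ladder_lim u w.
Let tau := ladder_lim w u.
Let g := limn (gain u w).

Let corr n J := \sum_(k < J) t (n + k)%N * tau k.

Let corr_ge0 n J : 0 <= corr n J.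
Proof.
apply: sumr_ge0 => k _; rewrite mulr_ge0 ?ladder_lim_ge0//; exact: ladder_dataC.
Qed.

Let corr_decr n J : corr n J - corr n.+1 J =
  tau 0 * t n - t (n + J)%N * tau J - series (fun k => t (n + k).+1 * decr tau k) J.
Proof.
rewrite /series/= big_mkord -sumrB; elim: J => [|J IH].
  by rewrite !big_ord0 addn0 mulrC subrr subrr.
by rewrite !big_ord_recr/= IH /decr addnS addSn; ring.
Qed.

Let corr_decr_cvg n : (fun J => corr n J - corr n.+1 J) @ \oo --> g * u n - (1 - tau 0) * t n.
Proof.
have -> : g * u n - (1 - tau 0) * t n = tau 0 * t n - 0 - (t n - g * u n) by ring.
under eq_cvg do rewrite corr_decr.
apply: cvgB; last exact: ladder_lim_eq.
apply: cvgB; first exact: cvg_cst.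
have d' := ladder_dataC d.
apply: (squeeze_cvgr _ (cvg_cst 0) (ladder_lim_cvg0 d')).
near=> J; rewrite mulr_ge0 ?ladder_lim_ge0//=.
by rewrite ler_piMl ?ladder_lim_ge0// ladder_lim_le1.
Unshelve. all: by end_near. Qed.

Let corr_decr_le n J : corr n J - corr n.+1 J <= g * u n - (1 - tau 0) * t n.
Proof.
have c := @corr_decr_cvg n.
rewrite -(cvg_lim _ c)//; apply: nondecreasing_cvgn_le; last exact: cvgP c.
apply/nondecreasing_seqP => i; rewrite /corr !big_ord_recr/= addSn.
have : 0 <= (t (n + i)%N - t (n + i).+1) * tau i.
  apply: mulr_ge0; first exact: (ladder_lim_decr_ge0 (n + i) d).
  exact: (ladder_lim_ge0 i (ladder_dataC d)).
by rewrite mulrBl; lra.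
Qed.

Let g0 : 0 < g. Proof. exact: gain_lim_gt0. Qed.

Let p_ge0 n : 0 <= p n.
Proof.
apply: cvg0_nonincreasing_ge0 n => //; apply: nonincreasing_seqS => k.
by rewrite -subr_ge0 [_ - _]pu; case: d => -[].
Qed.

(** The differences corr n J - corr (n + M) J are bounded by g p_n for every M, and the subtracted
term disappears as M grows, as it is a sum of J terms that tend to 0. *)
Let corr_le n J : corr n J <= g * p n.
Proof.
have tau1 : tau 0 <= 1 by apply: ladder_lim_le1; exact: ladder_dataC.
have H M : corr n J - corr (n + M)%N J <= g * (p n - p (n + M)%N).
  elim: M => [|M IH]; first by rewrite addn0 !subrr mulr0.
  have := corr_decr_le (n + M) J; rewrite addnS -pu /decr.
  have : 0 <= (1 - tau 0) * t (n + M)%N.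
    by rewrite mulr_ge0 ?subr_ge0 ?ladder_lim_ge0.
  by move: IH; rewrite !mulrBr; lra.
have c : (fun M => corr n J - corr (n + M)%N J) @ \oo --> corr n J - 0.
  apply: cvgB; first exact: cvg_cst.
  have -> : 0 = \sum_(k < J) 0 * tau k :> R by rewrite big1// => k _; exact: mul0r.
  apply: (@cvg_sum_ord J (fun k M => t (n + M + k)%N * tau k) (fun k => 0 * tau k)) => k.
  apply: cvgMr_tmp; under eq_cvg do rewrite addnAC addnC.
  exact: cvg_shift0 (ladder_lim_cvg0 d).
rewrite subr0 in c; apply: (cvgr_to_le c); near=> M.
apply: le_trans (H M) _; rewrite ler_pM2l// lerBlDr lerDl; exact: p_ge0.
Unshelve. all: by end_near. Qed.

Let corr_cvg n : corr n @ \oo --> limn (corr n).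
Proof.
apply: nondecreasing_is_cvgn; last by exists (g * p n) => _ [j _ <-]; exact: corr_le.
apply/nondecreasing_seqP => J; rewrite /corr big_ord_recr/= lerDl.
by rewrite mulr_ge0 ?ladder_lim_ge0//; exact: ladder_dataC.
Qed.

(** The amount by which the factorization could fail.  It decreases to 0 in n, its decrement carries
the factor 1 - tau_0, and, when both sides have the same head, its value at 0 does not change if
u and w are exchanged. *)
Let defect n := g * p n - limn (corr n).

Let defect_ge0 n : 0 <= defect n.
Proof.
rewrite subr_ge0; apply: (cvgr_to_le (@corr_cvg n)); near=> J; exact: corr_le.
Unshelve. all: by end_near. Qed.

Let decr_defect n : decr defect n = (1 - tau 0) * t n.
Proof.
have E := cvg_unique (@Rhausdorff R) (cvgB (@corr_cvg n) (@corr_cvg n.+1)) (@corr_decr_cvg n).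
rewrite {1}/decr /defect.
have -> : limn (corr n) =
    g * (p n - p n.+1) - (1 - tau 0) * t n + limn (corr n.+1).
  by rewrite -[p n - _]/(decr p n) pu -E subrK.
by ring.
Qed.

Let defect_cvg0 : defect @ \oo --> (0 : R).
Proof.
have c : (fun n => g * p n) @ \oo --> (0 : R).
  by rewrite -(mulr0 g); exact: cvgMl_tmp.
apply: (squeeze_cvgr _ (cvg_cst 0) c); near=> n.
rewrite defect_ge0 /defect lerBlDr lerDl/=.
apply: (cvgr_to_ge (@corr_cvg n)); near=> J; exact: corr_ge0.
Unshelve. all: by end_near. Qed.

Let defect_nonincreasing : nonincreasing_seq defect.
Proof.
apply: nonincreasing_seqS => n; rewrite -subr_ge0 [_ - _]decr_defect.
rewrite mulr_ge0 ?subr_ge0 ?ladder_lim_ge0// ladder_lim_le1//.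
exact: ladder_dataC.
Qed.

Lemma ladder_corr_le n : exists2 l,
  (fun J => \sum_(k < J) t (n + k)%N * tau k) @ \oo --> l & 0 <= g * p n - l <= g * p 0%N - limn (corr 0%N).
Proof.
exists (limn (corr n)); first exact: corr_cvg.
by rewrite defect_ge0; exact: defect_nonincreasing.
Qed.

Lemma ladder_corr_eq : tau 0%N = 1 -> g * p 0%N = limn (corr 0%N).
Proof.
move=> tau1; apply/eqP; rewrite -subr_eq0 eq_le defect_ge0 andbT.
apply: (@decr_le_cvg0 defect (cst 0)) => //; first exact: cvg_cst.
by move=> n; rewrite decr_defect tau1 subrr mul0r /decr subrr.
Qed.
End corr.

(** One of t and tau has head 1, which makes one of the two defects constant, hence 0.  The two sides
share the defect at 0, and defects decrease, so they vanish on both sides.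
The constant of the factorization is absorbed into t. *)
Theorem wiener_hopf p q : p 0%N = q 0%N -> 0 < p 0%N ->
  p @ \oo --> (0 : R) -> q @ \oo --> (0 : R) ->
  logconvex (decr p) -> logconvex (decr q) ->
  exists t tau, [/\ logconvex t, logconvex tau, 0 < t 0%N & 0 < tau 0%N] /\
    (forall n, series (fun k => t (n + k)%N * tau k) @ \oo --> p n) /\
    (forall n, series (fun k => t k * tau (n + k)%N) @ \oo --> q n).
Proof.
move=> pq pgt0 p0 q0 lcp lcq.
have decr0 s : s @ \oo --> (0 : R) -> decr s @ \oo --> (0 : R).
  by move=> s0; rewrite -[0]subr0; apply: cvgB => //; rewrite cvg_shiftS.
have d : ladder_data (decr p) (decr q).
  split => //; [exact: decr0|exact: decr0|].
  rewrite ltr_pwDl//; last by case: lcq.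
  rewrite lt_def; case: (lcp) => -> _; rewrite andbT; apply: contraTneq pgt0 => E.
  rewrite -leNgt; apply: (@decr_le_cvg0 p (cst 0)) => //; first exact: cvg_cst.
  move=> n; rewrite {2}/decr subrr -E.
  exact: (logconvex_nonincreasing lcp (decr0 _ p0)).
have d' := ladder_dataC d.
pose t := ladder_lim (decr p) (decr q).
pose tau := ladder_lim (decr q) (decr p).
pose g := limn (gain (decr p) (decr q)).
have gE : limn (gain (decr q) (decr p)) = g.
  by rewrite /g (_ : gain (decr q) (decr p) = gain (decr p) (decr q))//; apply/funext => j; rewrite gainC.
have g0 : 0 < g by exact: gain_lim_gt0.
have corrC : limn (fun J => \sum_(k < J) tau (0 + k)%N * t k) =
             limn (fun J => \sum_(k < J) t (0 + k)%N * tau k).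
  congr (limn _); apply/funext => j.
  by apply: eq_bigr => k _; rewrite !add0n mulrC.
have E0 : g * p 0%N = limn (fun J => \sum_(k < J) t (0 + k)%N * tau k).
  have /eqP := ladder_lim_sum d; rewrite -/t -/tau mulf_eq0 !subr_eq0 => /orP[/eqP e|/eqP e].
    have := ladder_corr_eq d' q0 (fun=> erefl) (esym e).
    by rewrite gE -pq => ->.
  exact: (ladder_corr_eq d p0 (fun=> erefl) (esym e)).
have Ep n : (fun J => \sum_(k < J) t (n + k)%N * tau k) @ \oo --> g * p n.
  have [l cl] := ladder_corr_le d p0 (fun=> erefl) n.
  by rewrite E0 subrr => /le_anti/eqP; rewrite eq_sym subr_eq0 => /eqP ->.
have Eq n : (fun J => \sum_(k < J) tau (n + k)%N * t k) @ \oo --> g * q n.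
  have [l cl] := ladder_corr_le d' q0 (fun=> erefl) n.
  rewrite gE -pq E0 -/t -/tau corrC subrr.
  by move=> /le_anti/eqP; rewrite eq_sym subr_eq0 => /eqP ->.
have [tlc taulc] := (ladder_lim_logconvex d, ladder_lim_logconvex d').
have [tnd taund] := (ladder_lim_nonincreasing d, ladder_lim_nonincreasing d').
have nz : ~ (forall k, t k * tau k = 0).
  move=> z; suff : g * p 0%N = 0 by apply/eqP; rewrite mulf_neq0 ?gt_eqF.
  rewrite E0; under eq_fun do under eq_bigr do rewrite add0n z.
  by under eq_fun do rewrite big1//; rewrite lim_cst.
exists (fun n => g^-1 * t n), tau; split.
  split => //; first by apply: logconvexZ => //; rewrite invr_ge0 ltW.
    rewrite mulr_gt0 ?invr_gt0// lt_def (ladder_lim_ge0 _ d) andbT.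
    apply/eqP => z; apply: nz => k; suff -> : t k = 0 by rewrite mul0r.
    by apply/eqP; rewrite eq_le (ladder_lim_ge0 _ d) andbT -z; exact: tnd.
  rewrite lt_def (ladder_lim_ge0 _ d') andbT.
  apply/eqP => z; apply: nz => k; suff -> : tau k = 0 by rewrite mulr0.
  by apply/eqP; rewrite eq_le (ladder_lim_ge0 _ d') andbT -z; exact: taund.
split=> n.
  have -> : p n = g^-1 * (g * p n) by rewrite mulKf// gt_eqF.
  rewrite (_ : series _ = fun J => g^-1 * \sum_(k < J) t (n + k)%N * tau k).
    exact: cvgMl_tmp.
  apply/funext => J; rewrite /series/= big_mkord mulr_sumr.
  by apply: eq_bigr => k _; rewrite mulrA.
have -> : q n = g^-1 * (g * q n) by rewrite mulKf// gt_eqF.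
rewrite (_ : series _ = fun J => g^-1 * \sum_(k < J) tau (n + k)%N * t k).
  exact: cvgMl_tmp.
apply/funext => J; rewrite /series/= big_mkord mulr_sumr.
by apply: eq_bigr => k _; rewrite -mulrA [tau _ * _]mulrC.
Qed.

End wiener_hopf.

(** * Convolution as an operator on functions *)

Section averaging.
Context {R : realType}.
Implicit Types (f g : R -> \bar R) (H : distribution_function R).
Local Open Scope ereal_scope.

Definition nnmeas f := (forall x, 0 <= f x) /\
  @measurable_fun _ _ (measurableTypeR R) (\bar R) setT f.

Definition conv_op H f (x : R) : \bar R :=
  \int[lebesgue_stieltjes_measure H]_y f (x - y)%R.

Definition heaviside (x : R) : \bar R := (0 <= x)%R%:R%:E.

Lemma measurable_addR c :
  @measurable_fun _ _ (measurableTypeR R) (measurableTypeR R) setT (fun y : R => (y + c)%R).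
Proof. exact: (@measurable_funD _ R R setT id (cst c)). Qed.

Lemma measurable_subR c :
  @measurable_fun _ _ (measurableTypeR R) (measurableTypeR R) setT (fun y : R => (c - y)%R).
Proof. exact: (@measurable_funB _ R R setT (cst c) id). Qed.

Lemma nnmeas_shift f c : nnmeas f -> nnmeas (fun y => f (y + c)%R).
Proof.
move=> [f0 mf]; split=> //.
exact: (measurableT_comp mf (measurable_addR c)).
Qed.

Lemma nnmeas_refl f c : nnmeas f -> nnmeas (fun y => f (c - y)%R).
Proof.
move=> [f0 mf]; split=> //.
exact: (measurableT_comp mf (measurable_subR c)).
Qed.

Lemma nnmeas_affine f (c d : R) : (0 <= c)%R -> (0 <= d)%R -> nnmeas f ->
  nnmeas (fun x => c%:E * f x + d%:E).
Proof.
move=> c0 d0 [f0 mf]; split=> [x|]; first by rewrite adde_ge0 ?mule_ge0.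
by apply: emeasurable_funD => //; apply: measurable_funeM.
Qed.

Lemma nondecreasing_nnmeas f : (forall x, 0 <= f x) -> (forall x, f x <= 1) ->
  (forall x y, (x <= y)%R -> f x <= f y) -> nnmeas f.
Proof.
move=> f0 f1 fnd; split=> //.
have fin x : f x \is a fin_num.
  by rewrite ge0_fin_numE// (le_lt_trans (f1 x))// ltry.
have -> : f = EFin \o (fine \o f) by apply/funext => x /=; rewrite fineK.
apply/measurable_EFinP.
apply: (@nondecreasing_measurable R setT (fine \o f)) => // x y xy.
by rewrite /= fine_le// fnd.
Qed.

Lemma nnmeas_heaviside : nnmeas heaviside.
Proof.
apply: nondecreasing_nnmeas => x; rewrite /heaviside ?lee_fin//.
  by rewrite lern1 leq_b1.
move=> y xy; rewrite lee_fin ler_nat; case: (leP 0%R x) => // x0.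
by rewrite (le_trans x0 xy).
Qed.

Lemma measurable_subR2 (x : R) :
  @measurable_fun _ _ (measurableTypeR R * measurableTypeR R)%type (measurableTypeR R)
    setT (fun p : R * R => (x - p.1 - p.2)%R).
Proof.
apply: (@measurable_funB _ (measurableTypeR R * measurableTypeR R)%type R setT
   (fun p => x - p.1)%R snd).
  apply: (@measurable_funB _ (measurableTypeR R * measurableTypeR R)%type R setT
   (cst x) fst) => //.
exact: (@measurable_snd _ _ (measurableTypeR R) (measurableTypeR R)).
Qed.

Lemma conv_op_comm H G f : nnmeas f ->
  forall x, conv_op H (conv_op G f) x = conv_op G (conv_op H f) x.
Proof.
move=> [f0 mf] x; rewrite /conv_op.
have mF : @measurable_fun _ _ (measurableTypeR R * measurableTypeR R)%type (\bar R) setT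
    (fun p : R * R => f (x - p.1 - p.2)%R).
  exact: (measurableT_comp mf (measurable_subR2 x)).
have := @fubini_tonelli _ _ _ _ R (lebesgue_stieltjes_measure H)
  (lebesgue_stieltjes_measure G) _ mF (fun p => f0 _).
move=> /= ->; apply: eq_integral => y _; apply: eq_integral => z _.
by rewrite -addrA [(- _ - _)%R]addrC addrA.
Qed.

Lemma conv_op_nnmeas H f : nnmeas f -> nnmeas (conv_op H f).
Proof.
move=> [f0 mf]; split=> [x|]; first by apply: integral_ge0.
rewrite /conv_op.
have m2 : @measurable_fun _ _ (measurableTypeR R * measurableTypeR R)%type
    (measurableTypeR R) setT (fun p : R * R => (p.1 - p.2)%R).
  apply: (@measurable_funB _ (measurableTypeR R * measurableTypeR R)%type R setT fst snd) => //.
have mF : @measurable_fun _ _ (measurableTypeR R * measurableTypeR R)%type (\bar R) setT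
    (fun p : R * R => f (p.1 - p.2)%R).
  exact: (measurableT_comp mf m2).
exact: (@measurable_fun_fubini_tonelli_F _ _ _ _ R (lebesgue_stieltjes_measure H)
  _ mF (fun p => f0 _)).
Qed.

(** Properties of f |-> (x |-> E f(x - Z)) for a random variable Z.  They are stable under
composition, so that convolution roots can be combined and compared without constructing laws. *)
Record averaging (K : (R -> \bar R) -> R -> \bar R) : Prop := Averaging {
  avg_nnmeas : forall f, nnmeas f -> nnmeas (K f);
  avg_le : forall f g, nnmeas f -> nnmeas g -> (forall x, f x <= g x) ->
    forall x, K f x <= K g x;
  avg_affine : forall f (c d : R), nnmeas f -> (0 <= c)%R -> (0 <= d)%R ->
    forall x, K (fun y => c%:E * f y + d%:E) x = c%:E * K f x + d%:E;
  avg_shift : forall f e, nnmeas f ->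
    forall x, K (fun y => f (y + e)%R) x = K f (x + e)%R;
  avg_comm : forall f H, nnmeas f ->
    forall x, K (conv_op H f) x = conv_op H (K f) x }.

Lemma averaging_conv_op H : averaging (conv_op H).
Proof.
split.
- by move=> f; exact: conv_op_nnmeas.
- move=> f g mf mg fg x; apply: ge0_le_integral => //.
  + by move=> y _; case: mf.
  + by case: (nnmeas_refl x mf).
  + by case: (nnmeas_refl x mg).
- move=> f c d mf c0 d0 x; rewrite /conv_op.
  have [f0 mfx] := nnmeas_refl x mf.
  rewrite ge0_integralD//; last 2 first.
    by move=> y _; rewrite mule_ge0.
    exact: measurable_funeM.
  rewrite ge0_integralZl//; congr (_ + _).
  by rewrite integral_cst//= probability_setT mule1.
- move=> f e mf x; rewrite /conv_op; apply: eq_integral => y _.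
  by rewrite addrAC.
- by move=> f G mf x; exact: conv_op_comm.
Qed.

Lemma averaging_id : averaging id.
Proof. by split. Qed.

Lemma averaging_comp K L : averaging K -> averaging L -> averaging (K \o L).
Proof.
move=> hK hL; split=> /=.
- by move=> f mf; exact/(avg_nnmeas hK)/(avg_nnmeas hL).
- move=> f g mf mg fg; apply: (avg_le hK); [exact: (avg_nnmeas hL)..|].
  exact: (avg_le hL).
- move=> f c d mf c0 d0 x.
  rewrite (_ : L _ = fun y => c%:E * L f y + d%:E); last first.
    by apply/funext => y; rewrite (avg_affine hL).
  by rewrite (avg_affine hK)//; exact: (avg_nnmeas hL).
- move=> f e mf x.
  rewrite (_ : L _ = fun y => L f (y + e)%R); last first.
    by apply/funext => y; rewrite (avg_shift hL).
  by rewrite (avg_shift hK)//; exact: (avg_nnmeas hL).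
- move=> f H mf x.
  rewrite (_ : L _ = conv_op H (L f)); last first.
    by apply/funext => y; rewrite (avg_comm hL).
  by rewrite (avg_comm hK)//; exact: (avg_nnmeas hL).
Qed.

Lemma averaging_iter K n : averaging K -> averaging (iter n K).
Proof.
by move=> hK; elim: n => [|n IH]; [exact: averaging_id|exact: (averaging_comp hK IH)].
Qed.

Section averaging_theory.
Variables (K : (R -> \bar R) -> R -> \bar R) (hK : averaging K).

Lemma avg_cst (d : R) x : (0 <= d)%R -> K (fun=> d%:E) x = d%:E.
Proof.
move=> d0; have := avg_affine hK nnmeas_heaviside (lexx 0%R) d0 x.
rewrite mul0e add0e => {2}<-; congr (K _ x).
by apply/funext => y; rewrite mul0e add0e.
Qed.

Lemma avg_ge0 f x : nnmeas f -> 0 <= K f x.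
Proof. by move=> /(avg_nnmeas hK)[]. Qed.

Lemma avg_le1 f x : nnmeas f -> (forall y, f y <= 1) -> K f x <= 1.
Proof.
move=> mf f1; by rewrite -(@avg_cst 1 x)//; apply: (avg_le hK).
Qed.

Lemma avg_nondecreasing f : nnmeas f -> (forall x y, (x <= y)%R -> f x <= f y) ->
  forall x y, (x <= y)%R -> K f x <= K f y.
Proof.
move=> mf fnd x y xy.
have -> : y = (x + (y - x))%R by rewrite addrC subrK.
rewrite -(avg_shift hK)//; apply: (avg_le hK) => //; first exact: nnmeas_shift.
by move=> z; apply: fnd; rewrite lerDl subr_ge0.
Qed.

Lemma avg_heaviside_nondecreasing x y : (x <= y)%R -> K heaviside x <= K heaviside y.
Proof.
apply: avg_nondecreasing => //; first exact: nnmeas_heaviside.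
move=> {}x {}y xy; rewrite lee_fin ler_nat; case: (leP 0%R x) => // x0.
by rewrite (le_trans x0 xy).
Qed.

(** On the event Z <= x one has f(x + y - Z) >= f(y). *)
Lemma avg_tail_ge f (c : R) x y : nnmeas f -> (forall u v, (u <= v)%R -> f u <= f v) ->
  (0 <= c)%R -> c%:E <= f y -> c%:E * K heaviside x <= K f (x + y)%R.
Proof.
move=> mf fnd c0 cf; rewrite -(avg_shift hK)// -[leLHS]adde0.
rewrite -(avg_affine hK)//; last exact: nnmeas_heaviside.
apply: (avg_le hK).
- exact: nnmeas_affine nnmeas_heaviside.
- exact: nnmeas_shift.
- move=> z; rewrite adde0 /heaviside; case: (leP 0%R z) => z0.
    by rewrite mule1 (le_trans cf)// fnd// lerDr.
  by rewrite mule0; case: mf.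
Qed.

(** Only on the event Z <= x may f(x + y - Z) exceed f(y), and then it is at most 1. *)
Lemma avg_tail_le f (c : R) x y : nnmeas f -> (forall u v, (u <= v)%R -> f u <= f v) ->
  (forall u, f u <= 1) -> (0 <= c <= 1)%R -> f y <= c%:E ->
  K f (x + y)%R <= (1 - c)%:E * K heaviside x + c%:E.
Proof.
move=> mf fnd f1 /andP[c0 c1] fc; rewrite -(avg_shift hK)//.
rewrite -(avg_affine hK) ?subr_ge0//; last exact: nnmeas_heaviside.
apply: (avg_le hK).
- exact: nnmeas_shift.
- by apply: nnmeas_affine nnmeas_heaviside => //; rewrite subr_ge0.
- move=> z; rewrite /heaviside; case: (leP 0%R z) => z0.
    by rewrite mule1 -EFinD subrK.
  by rewrite mule0 add0e (le_trans _ fc)// fnd// gerDr ltW.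
Qed.

End averaging_theory.

(** One-sided Levy distances add up under convolution.  One factor at a time is exchanged, which is
legitimate because the two operators commute. *)
Lemma iter_levy_le K L (e : R) n : averaging K -> averaging L -> (0 <= e)%R ->
  (forall f, nnmeas f -> forall x, K (L f) x = L (K f) x) ->
  (forall x, K heaviside x <= L heaviside (x + e)%R + e%:E) ->
  forall x, iter n K heaviside x <= iter n L heaviside (x + n%:R * e)%R + (n%:R * e)%:E.
Proof.
move=> hK hL e0 KL H1; elim: n => [|n IH] x; first by rewrite !mul0r !addr0.
have Lh := averaging_iter n hL.
have mL := avg_nnmeas Lh nnmeas_heaviside.
have mK := avg_nnmeas (averaging_iter n hK) nnmeas_heaviside.
have ne0 : (0 <= n%:R * e)%R by rewrite mulr_ge0.
have KLn f : nnmeas f -> forall x, K (iter n L f) x = iter n L (K f) x.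
  move=> mf; elim: n {IH Lh mL mK ne0} => [//|m IHm] y /=.
  rewrite KL; last exact: (avg_nnmeas (averaging_iter m hL)).
  by congr (L _ y); apply/funext => z.
rewrite iterS.
apply: (@le_trans _ _ (K (fun y => 1%:E * iter n L heaviside (y + n%:R * e)%R + (n%:R * e)%:E) x)).
  apply: (avg_le hK) => //.
    by apply: nnmeas_affine => //; exact: nnmeas_shift.
  by move=> y; rewrite mul1e.
rewrite (avg_affine hK)//; last exact: nnmeas_shift.
rewrite mul1e (avg_shift hK)// KLn; last exact: nnmeas_heaviside.
have -> : (n.+1%:R * e = n%:R * e + e)%R by rewrite -natr1 mulrDl mul1r.
rewrite [(x + (_ + _))%R]addrA EFinD [(n%:R * e)%:E + _]addeC addeA leeD2r//.
set z := (x + n%:R * e)%R.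
rewrite iterSr.
have mL1 := avg_nnmeas hL nnmeas_heaviside.
apply: (@le_trans _ _ (iter n L (fun y => 1%:E * L heaviside (y + e)%R + e%:E) z)).
  apply: (avg_le Lh).
  - exact: (avg_nnmeas hK nnmeas_heaviside).
  - by apply: nnmeas_affine => //; exact: nnmeas_shift.
  - by move=> y; rewrite mul1e.
rewrite (avg_affine Lh)//; last exact: nnmeas_shift.
by rewrite mul1e (avg_shift Lh).
Qed.

End averaging.

(** * Helly's selection theorem *)

Section helly.
Context {R : realType}.

Lemma ultra_fmap (T V : Type) (f : T -> V) (U : set_system T) :
  UltraFilter U -> UltraFilter (f @ U).
Proof.
move=> UU; have PU := @ultra_proper _ _ UU.
split; first exact: fmap_proper_filter.
move=> G PG fUG; apply/seteqP; split => // A GA.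
have [//|UcA] := in_ultra_setVsetC (f @^-1` A) UU.
have GcA : G (~` A) by apply: fUG.
by have [x []] := @filter_ex _ G _ _ (filterI GA GcA).
Qed.

Lemma ultra_bounded_cvg (T : Type) (f : T -> R) (U : set_system T) (a b : R) :
  UltraFilter U -> (forall t, a <= f t <= b) -> exists l : R, f @ U --> l.
Proof.
move=> UU fab; have PU := @ultra_proper _ _ UU.
have := @segment_compact R a b; rewrite compact_ultra => /(_ _ (ultra_fmap f UU)).
have fU : (f @ U) `[a, b]%classic.
  by apply: (@filterE _ U) => t /=; rewrite in_itv/= fab.
by move=> /(_ fU)[l [_ fl]]; exists l.
Qed.

Lemma ex_distribution_function (H : R -> R) : nondecreasing_fun H ->
  right_continuous H -> H @ -oo --> (0 : R) -> H @ +oo --> (1 : R) ->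
  exists H' : distribution_function R, H =1 H'.
Proof.
move=> nd rc l0 l1.
pose mc := isCumulative.Build R _ R H nd rc.
pose mb := isCumulativeBounded.Build R 0 1 H l0 l1.
pose H' : distribution_function R := HB.pack H mc mb.
by exists H'.
Qed.

(** A pointwise limit along an ultrafilter exists by compactness of [0, 1] and is made
right-continuous by an infimum from the right; tightness makes it a distribution function.  The
uniform closeness in the Levy sense comes from closeness at the finitely many nodes of a grid of
mesh e on [-A, A], since all functions are monotone. *)
Lemma helly (g : nat -> R -> R) :
  (forall m x, 0 <= g m x <= 1) -> (forall m, nondecreasing_fun (g m)) ->
  (forall e : R, 0 < e -> exists2 A, 0 < A & \forall m \near \oo,
     g m (- A) <= e /\ 1 - e <= g m A) ->
  exists H : distribution_function R, forall e : R, 0 < e -> forall N,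
    exists2 m, (N <= m)%N & forall x, g m x <= H (x + e) + e /\ H x <= g m (x + e) + e.
Proof.
move=> g01 gnd tight.
have [U [UU oU]] := @ultraFilterLemma nat \oo _.
have PU := @ultra_proper _ _ UU.
have /choice[g0 gl] : forall x, exists l : R, g ^~ x @ U --> l.
  by move=> x; apply: (@ultra_bounded_cvg _ _ _ 0 1).
have g001 x : 0 <= g0 x <= 1.
  apply/andP; split.
    by apply: (cvgr_to_ge (gl x)); apply: filterE => m; case/andP: (g01 m x).
  by apply: (cvgr_to_le (gl x)); apply: filterE => m; case/andP: (g01 m x).
have g0nd x y : x <= y -> g0 x <= g0 y.
  by move=> xy; apply: ler_cvg_to (gl x) (gl y) _; apply: filterE => m; exact: gnd.
pose S x := [set g0 y | y in [set y | x < y]].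
have S0 x : S x !=set0 by exists (g0 (x + 1)), (x + 1) => //=; rewrite ltrDl.
have Slb x : has_lbound (S x) by exists 0 => _ [y _ <-]; case/andP: (g001 y).
(* The right-continuous modification of the pointwise limit. *)
pose H x := inf (S x).
have g0H x : g0 x <= H x.
  by apply: lb_le_inf => // _ [y /= xy <-]; apply: g0nd; exact: ltW.
have Hg0 x y : x < y -> H x <= g0 y.
  by move=> xy; apply: ge_inf => //; exists y.
have Hnd x y : x <= y -> H x <= H y.
  rewrite le_eqVlt => /orP[/eqP -> //|xy]; exact: le_trans (Hg0 _ _ xy) (g0H y).
have H1 x : H x <= 1.
  by apply: le_trans (Hg0 x (x + 1) _) _; rewrite ?ltrDl//; case/andP: (g001 (x + 1)).
have H0 x : 0 <= H x by apply: le_trans (g0H x); case/andP: (g001 x).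
have tail e : 0 < e -> exists2 A, 0 < A & g0 (- A) <= e /\ 1 - e <= g0 A.
  move=> e0; have [A A0 gA] := tight e e0; exists A => //; split.
    by apply: (cvgr_to_le (gl (- A))); apply: oU; apply: filterS gA => m [].
  by apply: (cvgr_to_ge (gl A)); apply: oU; apply: filterS gA => m [].
have Hrc : right_continuous H.
  move=> x; apply/cvgrPdist_le => e e0.
  have [_ [z /= xz <-] gz] := inf_adherent e0 (conj (S0 x) (Slb x)).
  near=> y; rewrite ler0_norm ?subr_le0; last by apply: Hnd; near: y; exact: nbhs_right_ge.
  rewrite opprB lerBlDl; apply: le_trans (ltW gz).
  by apply: Hg0; near: y; exact: nbhs_right_lt.
have Hy : H @ +oo --> (1 : R).
  apply/cvgrPdist_le => e e0; have [A A0 [_ gA]] := tail e e0.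
  near=> y; rewrite ger0_norm ?subr_ge0// lerBlDl -lerBlDr.
  apply: le_trans gA _; apply: le_trans (g0H A) _; apply: Hnd.
  by near: y; apply: nbhs_pinfty_ge; exact: num_real.
have HNy : H @ -oo --> (0 : R).
  apply/cvgrPdist_le => e e0; have [A A0 [gA _]] := tail e e0.
  near=> y; rewrite sub0r normrN ger0_norm//.
  apply: le_trans gA; apply: Hg0.
  by near: y; apply: nbhs_ninfty_lt; exact: num_real.
have [H' HE] := ex_distribution_function Hnd Hrc HNy Hy.
exists H' => e e0 N.
have [A A0 gA] := tight e e0.
have [gNA0 gA0] : g0 (- A) <= e /\ 1 - e <= g0 A.
  split.
    by apply: (cvgr_to_le (gl (- A))); apply: oU; apply: filterS gA => m [].
  by apply: (cvgr_to_ge (gl A)); apply: oU; apply: filterS gA => m [].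
pose M := (Num.truncn (2 * A / e)).+1.
pose p (i : nat) := - A + i%:R * e.
have grid : U [set m | forall i : 'I_M.+1, `|g0 (p i) - g m (p i)| <= e].
  apply: (@filter_forall _ _ (fun i : 'I_M.+1 => [set m | `|g0 (p i) - g m (p i)| <= e])) => i.
  by have /cvgrPdist_le := gl (p i); exact.
have UA := oU _ gA.
have UN : U [set m | (N <= m)%N] by apply: oU; exact: nbhs_infty_ge.
have [m [[[gm1 gm2] Nm] gm]] := @filter_ex _ U _ _ (filterI (filterI UA UN) grid).
exists m => // x; rewrite -!HE.
have [xA|Ax] := ltP x (- A).
  split.
    rewrite ler_wpDl//; apply: le_trans gm1; apply: gnd; exact: ltW.
  rewrite ler_wpDl//; first by case/andP: (g01 m (x + e)).
  by apply: le_trans gNA0; exact: Hg0.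
have [xA|xA] := leP A x.
  have Axe : A <= x + e by rewrite (le_trans xA)// lerDl ltW.
  split.
    apply: (@le_trans _ _ 1); first by case/andP: (g01 m x).
    by rewrite -lerBlDr (le_trans gA0)// (le_trans (g0H A))// Hnd.
  by rewrite (le_trans (H1 x))// -lerBlDr (le_trans gm2)// gnd.
pose i := Num.truncn ((x + A) / e).
have xAe0 : 0 <= (x + A) / e by apply: divr_ge0; [lra|exact: ltW].
have iM : (i.+1 < M.+1)%N.
  rewrite ltnS /M ltnS; apply: le_truncn; apply: ler_wpM2r; first by rewrite invr_ge0 ltW.
  by lra.
have [il ir] : i%:R * e <= x + A /\ x + A < i.+1%:R * e.
  have /andP[h1 h2] := truncn_itv xAe0.
  by rewrite -ler_pdivlMr// -ltr_pdivrMr.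
have xp : x < p i.+1 by rewrite /p; lra.
have px : p i.+1 <= x + e.
  by rewrite /p -natr1 mulrDl mul1r; lra.
have := gm (Ordinal iM); rewrite /= ler_distlC => /andP[d1 d2].
split.
  apply: (le_trans (gnd m _ _ (ltW xp))); apply: (le_trans d2); rewrite lerD2r.
  by apply: le_trans (g0H _) _; exact: Hnd.
apply: (le_trans (Hg0 _ _ xp)); rewrite lerBlDr in d1; apply: (le_trans d1).
by rewrite lerD2r gnd.
Unshelve. all: by end_near. Qed.

End helly.

(** * Limits of convolution powers *)

Section levy_limit.
Context {R : realType}.
Implicit Types (H F : distribution_function R).

Lemma conv_op_heaviside H x : conv_op H heaviside x = (H x)%:E.
Proof.
have -> : (H x)%:E = lebesgue_stieltjes_measure H `]-oo, x]%classic.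
  by symmetry; exact: (@cdf_lebesgue_stieltjes_id R H x).
have mI : @measurable _ (measurableTypeR R) `]-oo, x]%classic by exact: (@measurable_itv R).
have := @integral_indic _ (measurableTypeR R) R (lebesgue_stieltjes_measure H)
  _ measurableT _ mI.
rewrite setIT => <-.
rewrite /conv_op; apply: eq_integral => y _.
by rewrite /heaviside indicE mem_setE in_itv/= subr_ge0.
Qed.

Lemma avg_bounds (K : (R -> \bar R) -> R -> \bar R) n x : averaging K ->
  (0 <= iter n K heaviside x <= 1)%E.
Proof.
move=> hK; have hKn := averaging_iter n hK.
rewrite (avg_ge0 hKn)//=; last exact: nnmeas_heaviside.
apply: (avg_le1 hKn); first exact: nnmeas_heaviside.
by move=> y; rewrite lee_fin lern1 leq_b1.
Qed.

Lemma avg_fin (K : (R -> \bar R) -> R -> \bar R) n x : averaging K ->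
  iter n K heaviside x \is a fin_num.
Proof.
move=> hK; have /andP[a0 a1] := avg_bounds n x hK.
by rewrite ge0_fin_numE// (le_lt_trans a1)// ltry.
Qed.

(** H itself is the operator applied to the indicator of [0, +oo), so that all the factors of the
convolution play the same role. *)
Lemma nfold_convolutionE H n x :
  (nfold_convolution H n.+1 x)%:E = iter n.+1 (conv_op H) heaviside x.
Proof.
elim: n x => [|n IH] x; first by rewrite /= conv_op_heaviside.
rewrite iterS /nfold_convolution /= -/(nfold_convolution H n.+1).
rewrite /convolution /Rintegral fineK.
  by apply: eq_integral => y _; exact: IH.
rewrite (_ : integral _ _ _ = iter n.+2 (conv_op H) heaviside x).
  exact: (avg_fin n.+2 x (averaging_conv_op H)).
by apply: eq_integral => y _; exact: IH.
Qed.

(** For monotone functions this is right-continuity; dominated convergence requires a sequence. *)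
Definition right_cvg (f : R -> \bar R) := forall x,
  (fun k => f (x + k.+1%:R^-1)) @ \oo --> f x.

Lemma right_cvg_heaviside : right_cvg heaviside.
Proof.
move=> x; rewrite /heaviside; have [x0|x0] := leP 0 x.
  rewrite (_ : (fun k => _) = cst 1%E); first exact: cvg_cst.
  by apply/funext => k; rewrite addr_ge0 ?invr_ge0.
have Nx0 : 0 < - x by rewrite oppr_gt0.
apply: cvg_near_cst; near=> k; rewrite leNgt (_ : x + k.+1%:R^-1 < 0)//.
rewrite -ltrBrDl sub0r; near: k; exact: (near_infty_natSinv_lt (PosNum Nx0)).
Unshelve. all: by end_near. Qed.

Lemma right_cvg_conv_op H f : nnmeas f -> (forall x, f x <= 1)%E -> right_cvg f ->
  right_cvg (conv_op H f).
Proof.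
move=> mf f1 fr x; rewrite /conv_op.
apply: (@dominated_cvg _ (measurableTypeR R) R (lebesgue_stieltjes_measure H) setT
  measurableT (fun k y => f (x + k.+1%:R^-1 - y)) _ (cst 1%E)) => //.
- by move=> k; case: (nnmeas_refl (x + k.+1%:R^-1) mf).
- by move=> y _; under eq_cvg do rewrite addrAC; exact: fr.
- exact: finite_measure_integrable_cst.
- by move=> k y _; rewrite gee0_abs//; case: mf.
Qed.

Lemma right_cvg_iter H n : right_cvg (iter n (conv_op H) heaviside).
Proof.
elim: n => [|n IH]; first exact: right_cvg_heaviside.
apply: right_cvg_conv_op IH.
  exact: (avg_nnmeas (averaging_iter n (averaging_conv_op H)) nnmeas_heaviside).
by move=> x; case/andP: (avg_bounds n x (averaging_conv_op H)).
Qed.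

Definition right_le (f : R -> R) := forall x e : R, 0 < e -> exists2 d : R, 0 < d & f (x + d) <= f x + e.

(** Two functions at Levy distance 0 are ordered when the larger one is right-continuous. *)
Lemma right_le_le (f g : R -> R) : {homo g : x y / x <= y} -> right_le g ->
  (forall d : R, 0 < d -> forall x, f x <= g (x + d) + d) -> forall x, f x <= g x.
Proof.
move=> gnd gr fg x; apply/ler_addgt0Pr => e e0.
have e20 : 0 < e / 2 by rewrite divr_gt0.
have [d d0 gd] := gr x _ e20.
pose m := Num.min d (e / 2).
have m0 : 0 < m by rewrite lt_min d0.
have := fg _ m0 x.
have : g (x + m) <= g (x + d) by apply: gnd; rewrite lerD2l ge_min lexx.
have : m <= e / 2 by rewrite ge_min lexx orbT.
by lra.
Qed.

Lemma right_le_distribution F : right_le F.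
Proof.
move=> x e e0; have [d Hd] := @nondecreasing_right_continuousP R x e F e0.
by exists d%:num.
Qed.

Lemma right_le_nfold H n : right_le (nfold_convolution H n.+1).
Proof.
move=> x e e0.
have := @right_cvg_iter H n.+1 x.
rewrite -nfold_convolutionE; under eq_cvg do rewrite -nfold_convolutionE.
move/fine_cvgP => [_] /cvgrPdist_le /(_ e e0)[k _ /(_ k (leqnn k))] /=.
rewrite ler_distlC => /andP[_ h].
by exists k.+1%:R^-1; rewrite ?invr_gt0.
Qed.

Lemma nfold_nondecreasing H n : {homo nfold_convolution H n.+1 : x y / x <= y}.
Proof.
move=> x y xy; rewrite -lee_fin !nfold_convolutionE.
have hK := averaging_iter n.+1 (averaging_conv_op H).
exact: (avg_heaviside_nondecreasing hK).
Qed.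

Section tightness.
Variables (K : (R -> \bar R) -> R -> \bar R) (hK : averaging K).
Let a x := fine (K heaviside x).

Let aE x : K heaviside x = (a x)%:E.
Proof. by rewrite /a fineK//; exact: (avg_fin 1 x hK). Qed.

Let a01 x : 0 <= a x <= 1.
Proof. by have := avg_bounds 1 x hK; rewrite /= aE !lee_fin. Qed.

Let iter_nd n x y : x <= y -> (iter n K heaviside x <= iter n K heaviside y)%E.
Proof. by move=> xy; exact: (avg_heaviside_nondecreasing (averaging_iter n hK)). Qed.

Let iter_nnmeas n : nnmeas (iter n K heaviside).
Proof. exact: (avg_nnmeas (averaging_iter n hK) nnmeas_heaviside). Qed.

(** If the n independent summands are all at most x then their sum is at most n x. *)
Lemma avg_iter_ge n x : ((a x ^+ n)%R%:E <= iter n K heaviside (n%:R * x)%R)%E.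
Proof.
have /andP[a0 a1] := a01 x.
elim: n => [|n IH]; first by rewrite /= mul0r expr0 /heaviside (lexx (0 : R)).
rewrite iterS -nat1r mulrDl mul1r exprSr EFinM -aE.
by apply: (avg_tail_ge hK) => //; [exact: iter_nd|rewrite exprn_ge0].
Qed.

(** If the n independent summands all exceed x then so does their mean. *)
Lemma avg_iter_le n x :
  (iter n.+1 K heaviside (n.+1%:R * x)%R <= (1 - (1 - a x) ^+ n.+1)%R%:E)%E.
Proof.
have /andP[a0 a1] := a01 x.
have b01 : 0 <= 1 - a x <= 1 by rewrite subr_ge0 a1 gerBl.
elim: n => [|n IH]; first by rewrite mul1r /= aE lee_fin expr1 opprB addrC subrK.
rewrite iterS -[n.+2%:R]nat1r mulrDl mul1r.
have /andP[b0 b1] := b01.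
have c1 : (1 - a x) ^+ n.+1 <= 1 by exact: exprn_ile1.
have c0 : 0 <= (1 - a x) ^+ n.+1 by exact: exprn_ge0.
apply: (@le_trans _ _ ((1 - (1 - (1 - a x) ^+ n.+1))%:E * K heaviside x +
    (1 - (1 - a x) ^+ n.+1)%:E)%E).
  apply: (avg_tail_le hK) => //.
  - exact: iter_nd.
  - by move=> u; case/andP: (avg_bounds n.+1 u hK).
  - by rewrite subr_ge0 c1 gerBl.
by rewrite aE -EFinM -EFinD lee_fin [X in _ <= 1 - X]exprS; lra.
Qed.

End tightness.

Lemma eps_split n (e : R) : 0 < e -> exists2 d : R, 0 < d & e = n.+1%:R * d + d.
Proof.
move=> e0; exists (e / n.+2%:R); first by rewrite divr_gt0.
by rewrite -[X in _ + X]mul1r -mulrDl natr1 mulrC divfK// pnatr_eq0.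
Qed.

(** The two tail bounds on iterates make the roots K tight, so they have a weak limit point H in the
Levy sense.  Closeness of the roots to H passes to n-fold powers, and F is right-continuous. *)
Theorem levy_limit F n :
  (forall e : R, 0 < e -> exists2 K, averaging K & forall x,
    (iter n.+1 K heaviside x <= (F (x + e) + e)%R%:E /\
     (F x)%:E <= iter n.+1 K heaviside (x + e)%R + e%:E)%E) ->
  exists H, nfold_convolution H n.+1 =1 F.
Proof.
move=> HF.
have /choice[K HK] : forall m : nat, exists K, averaging K /\ forall x,
    (iter n.+1 K heaviside x <= (F (x + m.+1%:R^-1) + m.+1%:R^-1)%R%:E /\
     (F x)%:E <= iter n.+1 K heaviside (x + m.+1%:R^-1)%R + (m.+1%:R^-1)%:E)%E.
  move=> m; have m0 : 0 < m.+1%:R^-1 :> R by rewrite invr_gt0.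
  by have [K hK KF] := HF _ m0; exists K.
pose g m x := fine (K m heaviside x).
have hK m : averaging (K m) by case: (HK m).
have gE m x : K m heaviside x = (g m x)%:E.
  by rewrite /g fineK//; exact: (avg_fin 1 x (hK m)).
have g01 m x : 0 <= g m x <= 1.
  by have := avg_bounds 1 x (hK m); rewrite /= gE !lee_fin.
have gnd m : nondecreasing_fun (g m).
  by move=> x y xy; rewrite -lee_fin -!gE; exact: (avg_heaviside_nondecreasing (hK m)).
have Fnd x y : x <= y -> F x <= F y.
  by move=> xy; exact: (cumulative_is_nondecreasing F).
have [H HH] : exists H : distribution_function R, forall e : R, 0 < e -> forall N,
    exists2 m, (N <= m)%N & forall x, g m x <= H (x + e) + e /\ H x <= g m (x + e) + e.
  apply: helly => // e e0.
  (* One half for the tail of F, one half for the Levy distance between the power and F. *)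
  pose r := e ^+ n.+1 / 2.
  have r0 : 0 < r by rewrite divr_gt0// exprn_gt0.
  have [B B0 [FB1 FB2]] : exists2 B, 0 < B & F (- B) <= r /\ 1 - r <= F B.
    have n1 : \forall x \near +oo, 1 - r <= F x.
      have /cvgrPdist_le /(_ r r0) := cumulativey F.
      by apply: filterS => x; rewrite ler_distlC => /andP[].
    have n2 : \forall x \near +oo, F (- x) <= r.
      have /cvgrPdist_le /(_ r r0) := cumulativeNy F.
      move=> [M [Mr HM]]; exists (- M); split; first by rewrite realN.
      move=> x Mx; have := HM (- x); rewrite ltrNl => /(_ Mx).
      by rewrite ler_distlC => /andP[_]; rewrite add0r.
    near (pinfty_nbhs R) => B.
    exists B; first by near: B; apply: nbhs_pinfty_gt; exact: num_real.
    by split; near: B.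
  exists (B + 1); first by rewrite addr_gt0.
  near=> m.
  have d0 : 0 < m.+1%:R^-1 :> R by rewrite invr_gt0.
  have dr : m.+1%:R^-1 <= r.
    by apply: ltW; near: m; exact: (near_infty_natSinv_lt (PosNum r0)).
  have d1 : m.+1%:R^-1 <= 1 :> R by rewrite invf_le1// ler1n.
  have nB : B + 1 <= n.+1%:R * (B + 1).
    by apply: ler_peMl; [lra|rewrite ler1n].
  have [_ KF] := HK m.
  move: d0 dr d1 KF; set d := m.+1%:R^-1 => d0 dr d1 KF.
  have rr : r + r = e ^+ n.+1 by rewrite /r -splitr.
  split.
    rewrite -(@ler_pXn2r _ n.+1)// ?nnegrE ?(ltW e0)//; last by case/andP: (g01 m (- (B + 1))).
    rewrite -lee_fin; apply: (le_trans (avg_iter_ge (hK m) n.+1 _)).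
    apply: (le_trans (KF _).1); rewrite lee_fin -rr; apply: lerD => //.
    by apply: le_trans FB1; apply: Fnd; rewrite mulrN; lra.
  have := (KF (n.+1%:R * (B + 1) - d)).2; rewrite subrK => KF2.
  have KF3 := le_trans KF2 (leeD2r d%:E (avg_iter_le (hK m) n (B + 1))).
  rewrite -EFinD lee_fin in KF3.
  have FBB : F B <= F (n.+1%:R * (B + 1) - d) by apply: Fnd; lra.
  have : (1 - g m (B + 1)) ^+ n.+1 <= e ^+ n.+1.
    by rewrite -rr /g; lra.
  rewrite ler_pXn2r// ?nnegrE ?subr_ge0 ?(ltW e0)//; last by case/andP: (g01 m (B + 1)).
  by lra.
exists H => x; apply/eqP; rewrite eq_le; apply/andP; split.
  apply: right_le_le; [exact: Fnd|exact: right_le_distribution|] => {x} e e0 x.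
  have [d d0 eE] := eps_split n e0.
  pose N := (Num.truncn d^-1).
  have [m Nm gH] := HH d d0 N.
  have md : m.+1%:R^-1 <= d.
    rewrite -[d]invrK lef_pV2 ?posrE ?invr_gt0//.
    by rewrite (le_trans (ltW (truncnS_gt _)))// ler_nat ltnS.
  rewrite -lee_fin nfold_convolutionE.
  have := @iter_levy_le _ (conv_op H) (K m) d n.+1 (averaging_conv_op H) (hK m) (ltW d0).
  move=> /(_ (fun f mf x => esym (avg_comm (hK m) H mf x))) L.
  have {}L := L (fun y => _); apply: (le_trans (L _ x)).
    by move=> y; rewrite conv_op_heaviside gE -EFinD lee_fin; case: (gH y).
  apply: (le_trans (leeD2r _ ((HK m).2 _).1)).
  rewrite -EFinD lee_fin.
  have : F (x + n.+1%:R * d + m.+1%:R^-1) <= F (x + e).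
    by apply: Fnd; rewrite eE -addrA lerD2l lerD2l.
  by move=> h; rewrite eE addrAC [leRHS]addrA; apply: lerD => //; rewrite lerD2r -eE.
apply: right_le_le; [exact: nfold_nondecreasing|exact: right_le_nfold|] => {x} e e0 x.
have [d d0 eE] := eps_split n e0.
pose N := (Num.truncn d^-1).
have [m Nm gH] := HH d d0 N.
have md : m.+1%:R^-1 <= d.
  rewrite -[d]invrK lef_pV2 ?posrE ?invr_gt0//.
  by rewrite (le_trans (ltW (truncnS_gt _)))// ler_nat ltnS.
rewrite -lee_fin EFinD nfold_convolutionE.
apply: (le_trans ((HK m).2 x).2).
have := @iter_levy_le _ (K m) (conv_op H) d n.+1 (hK m) (averaging_conv_op H) (ltW d0).
move=> /(_ (fun f mf x => avg_comm (hK m) H mf x)) L.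
apply: (le_trans (leeD2r _ (L _ (x + m.+1%:R^-1)))).
  by move=> y; rewrite conv_op_heaviside gE -EFinD lee_fin; case: (gH y).
rewrite -!nfold_convolutionE -!EFinD lee_fin.
have : nfold_convolution H n.+1 (x + m.+1%:R^-1 + n.+1%:R * d) <=
       nfold_convolution H n.+1 (x + e).
  by apply: nfold_nondecreasing; rewrite eE -addrA lerD2l addrC lerD2l.
by move=> h; rewrite eE [leRHS]addrA; apply: lerD => //; rewrite lerD2r -eE.
Unshelve. all: by end_near. Qed.

End levy_limit.

(** * Lattice measures *)

Section lattice.
Context {R : realType}.
Implicit Types (a b t : nat -> R) (f : R -> \bar R).
Local Open Scope ereal_scope.

Lemma nneseries_mkshift (f : nat -> \bar R) m : (forall k, 0 <= f k) ->
  \sum_(k <oo) (if (m <= k)%N then f k else 0) = \sum_(i <oo) f (i + m)%N.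
Proof.
move=> f0; set g := fun k => if (m <= k)%N then f k else 0.
have g0 k : 0 <= g k by rewrite /g; case: ifP.
rewrite (nneseries_split 0%N m); last by move=> k _; exact: g0.
rewrite add0n big_nat big1 ?add0e; last first.
  by move=> k /andP[_ km]; rewrite leqNgt km.
rewrite -(@nneseries_addn _ g)//; apply: eq_eseriesr => i _.
by rewrite /g leq_addl.
Qed.

Lemma nneseries_ord (f : nat -> \bar R) n : (forall k, 0 <= f k) ->
  \sum_(k <oo) (if (k < n)%N then f k else 0) = \sum_(k < n) f k.
Proof.
move=> f0; set g := fun k => if (k < n)%N then f k else 0.
have g0 k : 0 <= g k by rewrite /g; case: ifP.
rewrite (nneseries_split 0%N n); last by move=> k _; exact: g0.
rewrite add0n big_mkord -(@nneseries_addn _ g)//.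
rewrite [X in _ + X]eseries0 ?adde0; last first.
  by move=> k _ _; rewrite /g ltnNge leq_addl.
by apply: eq_bigr => k _; rewrite ltn_ord.
Qed.

Lemma nneseries_EFin (c : nat -> R) (l : R) : (forall k, (0 <= c k)%R) ->
  series c @ \oo --> l -> \sum_(k <oo) (c k)%:E = l%:E.
Proof.
move=> c0 cl; apply/cvg_lim => //.
rewrite (_ : (fun n => _) = EFin \o series c); last first.
  by apply/funext => n; rewrite /series/= sumEFin.
by apply/cvg_EFin => //; exact: nearW.
Qed.

(** Convolution with the measure that puts mass a_k at h k.  A negative h reflects the lattice. *)
Definition lat_op a (h : R) f x : \bar R := \sum_(k <oo) (a k)%:E * f (x - h * k%:R)%R.

Section nonneg.
Variables (a : nat -> R) (h : R).
Hypothesis a0 : forall k, (0 <= a k)%R.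

Lemma lat_op_nnmeas f : nnmeas f -> nnmeas (lat_op a h f).
Proof.
move=> mf; split=> [x|].
  by apply: nneseries_ge0 => k _ _; rewrite mule_ge0 ?lee_fin//; case: mf.
apply: ge0_emeasurable_sum => [k x _ _|k _].
  by rewrite mule_ge0 ?lee_fin//; case: mf.
by apply: measurable_funeM; case: (nnmeas_shift (- (h * k%:R)) mf).
Qed.

Lemma lat_op_le f g : (forall x, 0 <= f x) -> (forall x, f x <= g x) ->
  forall x, lat_op a h f x <= lat_op a h g x.
Proof.
move=> f0 fg x; apply: lee_nneseries => k *; first by rewrite mule_ge0 ?lee_fin.
by rewrite lee_wpmul2l ?lee_fin.
Qed.

Lemma lat_op_comm f H : nnmeas f ->
  forall x, lat_op a h (conv_op H f) x = conv_op H (lat_op a h f) x.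
Proof.
move=> mf x; have [f0 _] := mf.
rewrite /conv_op /lat_op integral_nneseries//; last 2 first.
- move=> k; apply: measurable_funeM.
  case: (nnmeas_refl (x - h * k%:R)%R mf) => _.
  by apply: eq_measurable_fun => y _; rewrite addrAC.
- by move=> k y _; rewrite mule_ge0 ?lee_fin.
apply: eq_eseriesr => k _.
rewrite -ge0_integralZl//; last 2 first.
- by case: (nnmeas_refl (x - h * k%:R)%R mf).
- by rewrite lee_fin.
by apply: eq_integral => y _; rewrite addrAC.
Qed.

Lemma averaging_lat_op : \sum_(k <oo) (a k)%:E = 1 -> averaging (lat_op a h).
Proof.
move=> a1; split.
- by move=> f; exact: lat_op_nnmeas.
- by move=> f g [f0 _] mg; exact: lat_op_le.
- move=> f c d [f0 mf] c0 d0 x; rewrite /lat_op.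
  transitivity (\sum_(k <oo) (c%:E * ((a k)%:E * f (x - h * k%:R)%R) + d%:E * (a k)%:E)).
    apply: eq_eseriesr => k _; rewrite ge0_muleDr ?mule_ge0 ?lee_fin//.
    by rewrite muleCA [d%:E * _]muleC.
  rewrite nneseriesD; last 2 first.
  - by move=> k *; rewrite !mule_ge0 ?lee_fin.
  - by move=> k *; rewrite !mule_ge0 ?lee_fin.
  rewrite !nneseriesZl ?a1 ?mule1//.
    by move=> k _; rewrite lee_fin.
  by move=> k _; rewrite mule_ge0 ?lee_fin//.
- by move=> f e mf x; apply: eq_eseriesr => k _; rewrite addrAC.
- by move=> f H mf x; exact: lat_op_comm.
Qed.

End nonneg.

(** The double sum is rearranged along the antidiagonals. *)
Lemma lat_op_lat_op a b h f : (forall k, (0 <= a k)%R) -> (forall k, (0 <= b k)%R) ->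
  (forall x, 0 <= f x) ->
  forall x, lat_op a h (lat_op b h f) x = lat_op (seqconv a b) h f x.
Proof.
move=> a0 b0 f0 x; rewrite /lat_op.
pose G j n := (a j * b (n - j)%N)%:E * f (x - h * n%:R)%R.
have G0 j n : 0 <= G j n by rewrite mule_ge0 ?lee_fin ?mulr_ge0.
transitivity (\sum_(j <oo) \sum_(n <oo) (if (j <= n)%N then G j n else 0)).
  apply: eq_eseriesr => j _; rewrite nneseries_mkshift//.
  rewrite -nneseriesZl; last by move=> k _; rewrite mule_ge0 ?lee_fin//.
  apply: eq_eseriesr => k _; rewrite /G addnK muleA -EFinM natrD mulrDr.
  by congr (_ * f _); rewrite opprD [(- _ - _)%R]addrC addrA addrAC.
rewrite nneseries_interchange; last by move=> j n; case: ifP.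
apply: eq_eseriesr => n _.
have -> := @nneseries_ord (fun j => G j n) n.+1 (G0 ^~ n).
rewrite -ge0_sume_distrl; last by move=> j _; rewrite lee_fin mulr_ge0.
by rewrite sumEFin.
Qed.

Lemma lat_opC a b h h' f : (forall k, (0 <= a k)%R) -> (forall k, (0 <= b k)%R) ->
  (forall x, 0 <= f x) ->
  forall x, lat_op a h (lat_op b h' f) x = lat_op b h' (lat_op a h f) x.
Proof.
move=> a0 b0 f0 x; rewrite /lat_op.
transitivity (\sum_(j <oo) \sum_(k <oo) (a j * b k)%:E * f (x - h * j%:R - h' * k%:R)%R).
  apply: eq_eseriesr => j _.
  rewrite -nneseriesZl; last by move=> k _; rewrite mule_ge0 ?lee_fin//.
  by apply: eq_eseriesr => k _; rewrite EFinM muleA.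
rewrite nneseries_interchange; last first.
  by move=> j k; rewrite mule_ge0 ?lee_fin ?mulr_ge0.
apply: eq_eseriesr => k _.
rewrite -nneseriesZl; last by move=> j _; rewrite mule_ge0 ?lee_fin//.
by apply: eq_eseriesr => j _; rewrite EFinM muleA addrAC [_ * (b k)%:E]muleC.
Qed.

Lemma lat_op_delta h f x : (forall x, 0 <= f x) ->
  lat_op (fun m => (m == 0%N)%:R%R) h f x = f x.
Proof.
move=> f0; rewrite /lat_op (nneseries_split 0%N 1%N)//; last first.
  by move=> k _; rewrite mule_ge0 ?lee_fin//.
rewrite add0n big_nat1 eqxx mulr0 subr0 mul1e -nneseries_addn.
  by rewrite eseries0 ?adde0// => k _ _; rewrite addn1 mul0e.
by move=> k; rewrite mule_ge0 ?lee_fin//.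
Qed.

Lemma seqpow_ge0 a n k : (forall k, (0 <= a k)%R) -> (0 <= seqpow a n k)%R.
Proof.
move=> a0; elim: n k => [|n IH] k; first by rewrite /seqpow/=.
by rewrite /seqpow iterS; apply: sumr_ge0 => i _; rewrite mulr_ge0// IH.
Qed.

Lemma iter_lat_op a h f n : (forall k, (0 <= a k)%R) -> nnmeas f ->
  forall x, iter n (lat_op a h) f x = lat_op (seqpow a n) h f x.
Proof.
move=> a0 mf; have [f0 _] := mf; elim: n => [|n IH] x; first by rewrite lat_op_delta.
rewrite iterS (_ : iter n _ _ = lat_op (seqpow a n) h f); last exact/funext.
by rewrite lat_op_lat_op// => k; exact: seqpow_ge0.
Qed.

(** Iterating the operator on the constant 1 raises the total mass S to the power n.  Infinite S is
excluded on the way, as no power of it could be 1. *)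
Lemma seqpow_total a n : (forall k, (0 <= a k)%R) ->
  \sum_(k <oo) (seqpow a n.+1 k)%:E = 1 -> \sum_(k <oo) (a k)%:E = 1.
Proof.
move=> a0 total.
have one0 : nnmeas (fun=> 1 : \bar R) by split => // x; rewrite lee_fin.
have [j aj] : exists j, (0 < a j)%R.
  apply: contrapT => /forallNP aN; have az k : a k = 0%R.
    by apply/eqP; rewrite eq_le a0 andbT leNgt; apply/negP; exact: aN.
  move: total; rewrite eseries0; first by move=> /esym/eqP; rewrite onee_eq0.
  by move=> k _ _; rewrite /seqpow iterS /seqconv big1// => i _; rewrite az mul0r.
set S := \sum_(k <oo) (a k)%:E.
have S0 : 0 <= S by apply: nneseries_ge0 => k _ _; rewrite lee_fin.
have Sgt0 : 0 < S.
  apply: (@lt_le_trans _ _ (\sum_(k < j.+1) (a k)%:E)).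
    rewrite big_ord_recr/=; apply: (@lt_le_trans _ _ (a j)%:E); first by rewrite lte_fin.
    by apply: leeDr; apply: sume_ge0 => i _; rewrite lee_fin.
  by rewrite -(big_mkord xpredT (fun k => (a k)%:E)); apply: nneseries_lim_ge => k _; rewrite lee_fin.
have H m x : iter m (lat_op a 0) (fun=> 1) x = S ^+ m.
  elim: m x => [|m IH] x; first by rewrite expe0.
  rewrite iterS /lat_op expeS.
  under eq_eseriesr do rewrite IH.
  have Sm0 : 0 <= S ^+ m by exact: expe_ge0.
  case: (S ^+ m) Sm0 => [r r0|_|//].
    under eq_eseriesr do rewrite muleC.
    by rewrite nneseriesZl 1?muleC// => k _; rewrite lee_fin.
  rewrite gt0_muley// (@nneseries_pinfty _ _ _ j)// => [k _|].
    by rewrite mule_ge0 ?lee_fin//.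
  by rewrite gt0_muley// lte_fin.
have : S ^+ n.+1 = 1.
  rewrite -(H n.+1 0%R) iter_lat_op// /lat_op.
  by under eq_eseriesr do rewrite mule1.
case: (S) S0 => [s s0| |//].
  rewrite -EFin_expe => -[] /eqP; rewrite pexprn_eq1// => /eqP ->.
  by [].
by move=> _; rewrite expeS gt0_mulye// expe_gt0.
Qed.

End lattice.

(** * Lattice laws with log-convex differences *)

Section lattice_law.
Context {R : realType}.
Implicit Types (t tau p q : nat -> R).

Lemma kaluza_lat_root t h n : logconvex t -> 0 < t 0%N ->
  (\sum_(k <oo) (t k)%:E = 1)%E ->
  exists r, [/\ (forall k, 0 <= r k), averaging (lat_op r h) &
    forall f, nnmeas f -> iter n.+1 (lat_op r h) f = lat_op t h f].
Proof.
move=> tlc t0 t1; have [r r0 rt] := kaluza_root n tlc t0.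
have rtE : seqpow r n.+1 = t by apply/funext.
exists r; split => //.
  by apply: averaging_lat_op => //; apply: (@seqpow_total _ _ n) => //; rewrite rtE.
by move=> f mf; apply/funext => x; rewrite iter_lat_op// rtE.
Qed.

Lemma iter_comp_comm (K L : (R -> \bar R) -> R -> \bar R) n f :
  averaging K -> averaging L ->
  (forall g, nnmeas g -> K (L g) = L (K g)) -> nnmeas f ->
  iter n (K \o L) f = iter n K (iter n L f).
Proof.
move=> hK hL KL mf; elim: n => [//|n IH].
have LK m g : nnmeas g -> L (iter m K g) = iter m K (L g).
  move=> mg; elim: m => [//|m IHm]; rewrite iterS -KL ?IHm//.
  exact: (avg_nnmeas (averaging_iter m hK) mg).
rewrite iterS IH /= LK//.
exact: (avg_nnmeas (averaging_iter n hL) mf).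
Qed.

Lemma two_sided_root t tau (h h' : R) n : logconvex t -> 0 < t 0%N ->
  logconvex tau -> 0 < tau 0%N ->
  (\sum_(k <oo) (t k)%:E = 1)%E -> (\sum_(k <oo) (tau k)%:E = 1)%E ->
  exists2 K, averaging K &
    iter n.+1 K heaviside = lat_op t h (lat_op tau h' heaviside).
Proof.
move=> tlc t0 taulc tau0 t1 tau1.
have [r [r0 hr rE]] := kaluza_lat_root h n tlc t0 t1.
have [s [s0 hs sE]] := kaluza_lat_root h' n taulc tau0 tau1.
exists (lat_op r h \o lat_op s h'); first exact: averaging_comp.
rewrite iter_comp_comm//; last 2 first.
- by move=> g [g0 _]; apply/funext => x; exact: lat_opC.
- exact: nnmeas_heaviside.
rewrite sE; last exact: nnmeas_heaviside.
rewrite rE//; apply: lat_op_nnmeas; last exact: nnmeas_heaviside.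
by case: taulc.
Qed.

Section double_series.
Variables (t tau p q : nat -> R) (h : R).
Hypotheses (t0 : forall k, 0 <= t k) (tau0 : forall k, 0 <= tau k) (h0 : 0 < h).
Hypothesis tp : forall n, series (fun k => t (n + k)%N * tau k) @ \oo --> p n.
Hypothesis tq : forall n, series (fun k => t k * tau (n + k)%N) @ \oo --> q n.
Local Open Scope ereal_scope.

Let G := lat_op t h (lat_op tau (- h) heaviside).

Let GE x : G x = \sum_(j <oo) \sum_(k <oo) (t j * tau k)%:E * heaviside (x - h * j%:R - - h * k%:R)%R.
Proof.
apply: eq_eseriesr => j _; rewrite -nneseriesZl; last first.
  by move=> k _; rewrite mule_ge0 ?lee_fin// /heaviside.
by apply: eq_eseriesr => k _; rewrite EFinM muleA.
Qed.

(** For X and Y with masses t and tau, the event X - Y <= -M is the disjoint union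
over i of the events Y = X + M + i. *)
Lemma lattice_law_left M : G (- (h * M%:R))%R = \sum_(i <oo) (q (i + M)%N)%:E.
Proof.
rewrite GE.
transitivity (\sum_(j <oo) \sum_(k <oo) (if (M + j <= k)%N then (t j * tau k)%:E else 0)).
  apply: eq_eseriesr => j _; apply: eq_eseriesr => k _; rewrite /heaviside.
  rewrite (_ : (- (h * M%:R) - h * j%:R - - h * k%:R = h * (k%:R - (M + j)%:R))%R); last first.
    by rewrite natrD; ring.
  rewrite pmulr_rge0// subr_ge0 ler_nat.
  by case: ifP; rewrite ?mule1 ?mule0.
transitivity (\sum_(j <oo) \sum_(i <oo) (t j * tau (i + M + j)%N)%:E).
  apply: eq_eseriesr => j _.
  rewrite (@nneseries_mkshift _ (fun k => (t j * tau k)%:E)).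
    by apply: eq_eseriesr => i _; rewrite addnA.
  by move=> k; rewrite lee_fin mulr_ge0.
rewrite nneseries_interchange; last by move=> i j; rewrite lee_fin mulr_ge0.
apply: eq_eseriesr => i _.
apply: (@nneseries_EFin _ (fun j => t j * tau (i + M + j)%N)%R) => [k|]; last exact: tq.
by rewrite mulr_ge0.
Qed.

(** The masses p account for the event X - Y > N, which is the complement of X - Y <= N. *)
Lemma lattice_law_right N : G (h * N%:R)%R + \sum_(i <oo) (p (i + N.+1)%N)%:E =
  \sum_(j <oo) \sum_(k <oo) (t j * tau k)%:E.
Proof.
have tt0 j k : 0 <= (t j * tau k)%:E by rewrite lee_fin mulr_ge0.
have -> : \sum_(i <oo) (p (i + N.+1)%N)%:E =
    \sum_(j <oo) \sum_(k <oo) (if (N.+1 + k <= j)%N then (t j * tau k)%:E else 0).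
  rewrite [RHS]nneseries_interchange; last by move=> j k; case: ifP.
  transitivity (\sum_(k <oo) \sum_(i <oo) (t (i + N.+1 + k)%N * tau k)%:E); last first.
    apply: eq_eseriesr => k _; rewrite (@nneseries_mkshift _ (fun j => (t j * tau k)%:E))//.
    by apply: eq_eseriesr => i _; rewrite addnA.
  rewrite nneseries_interchange//.
  apply: eq_eseriesr => i _; symmetry.
  apply: (@nneseries_EFin _ (fun k => t (i + N.+1 + k)%N * tau k)%R) => [k|]; last exact: tp.
  by rewrite mulr_ge0.
have hs0 x : 0 <= heaviside x :> \bar R by rewrite lee_fin.
have g0 j k : 0 <= (if (N.+1 + k <= j)%N then (t j * tau k)%:E else 0) by case: ifP.
rewrite GE -nneseriesD; last 2 first.
- by move=> j _ _; apply: nneseries_ge0 => k _ _; rewrite mule_ge0.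
- by move=> j _ _; apply: nneseries_ge0.
apply: eq_eseriesr => j _; rewrite -nneseriesD//; last by move=> k _ _; rewrite mule_ge0.
apply: eq_eseriesr => k _; rewrite /heaviside.
rewrite (_ : (h * N%:R - h * j%:R - - h * k%:R = h * ((N + k)%:R - j%:R))%R); last first.
  by rewrite natrD; ring.
rewrite pmulr_rge0// subr_ge0 ler_nat addSn ltnNge.
by case: leqP => _; rewrite ?mule1 ?mule0 ?adde0 ?add0e.
Qed.

End double_series.

(** The masses of the rounded law: rounding is towards 0, so the node 0 collects ]-h, h] and its mass
is common to both sides. *)
Definition right_mass (F : R -> R) (h : R) (n : nat) : R :=
  if n is 0%N then F h - F (- h) else F (h * n.+1%:R) - F (h * n%:R).

Definition left_mass (F : R -> R) (h : R) (n : nat) : R :=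
  if n is 0%N then F h - F (- h) else F (- (h * n%:R)) - F (- (h * n.+1%:R)).

Section approximation.
Variables (F : distribution_function R) (h : R).
Hypothesis h0 : 0 < h.

Let Fnd x y : x <= y -> F x <= F y.
Proof. exact: (cumulative_is_nondecreasing F). Qed.

Let cvg_hn : (fun n : nat => h * n%:R) @ \oo --> +oo.
Proof.
apply/cvgryPge => A; near=> n.
rewrite -ler_pdivrMl//; near: n; exact: nbhs_infty_ger.
Unshelve. all: by end_near. Qed.

Lemma cvg_distr_right : (fun n : nat => F (h * n%:R)) @ \oo --> (1 : R).
Proof. exact: (cvg_comp _ _ cvg_hn (cumulativey F)). Qed.

Lemma cvg_distr_left : (fun n : nat => F (- (h * n%:R))) @ \oo --> (0 : R).
Proof.
apply: (cvg_comp _ _ _ (cumulativeNy F)).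
apply: (cvg_comp _ _ cvg_hn); rewrite ninfty; exact: cvg_id.
Qed.

Lemma right_mass_sum N : series (fun i => right_mass F h (i + N.+1)%N) @ \oo -->
  1 - F (h * N.+1%:R).
Proof.
have E n : series (fun i => right_mass F h (i + N.+1)%N) n =
    F (h * (n + N.+1)%:R) - F (h * N.+1%:R).
  elim: n => [|n IH]; first by rewrite /series/= big_geq// add0n subrr.
  by move: IH; rewrite /series/= big_nat_recr//= => ->; rewrite addSn !addnS /=; ring.
rewrite (_ : series _ = fun n => F (h * (n + N.+1)%:R) - F (h * N.+1%:R)); last exact/funext.
apply: cvgB; last exact: cvg_cst.
by rewrite (cvg_shiftn N.+1 (fun n => F (h * n%:R))); exact: cvg_distr_right.
Qed.

Lemma left_mass_sum N : series (fun i => left_mass F h (i + N.+1)%N) @ \oo -->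
  F (- (h * N.+1%:R)).
Proof.
have E n : series (fun i => left_mass F h (i + N.+1)%N) n =
    F (- (h * N.+1%:R)) - F (- (h * (n + N.+1)%:R)).
  elim: n => [|n IH]; first by rewrite /series/= big_geq// add0n subrr.
  by move: IH; rewrite /series/= big_nat_recr//= => ->; rewrite addSn !addnS /=; ring.
rewrite (_ : series _ = fun n => F (- (h * N.+1%:R)) - F (- (h * (n + N.+1)%:R))); last exact/funext.
rewrite -[X in _ --> X]subr0; apply: cvgB; first exact: cvg_cst.
by rewrite (cvg_shiftn N.+1 (fun n => F (- (h * n%:R)))); exact: cvg_distr_left.
Qed.

Lemma right_mass_ge0 n : 0 <= right_mass F h n.
Proof.
case: n => [|n]; rewrite subr_ge0; apply: Fnd; last by rewrite ler_pM2l// ler_nat.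
by rewrite ge0_cp// ltW.
Qed.

Lemma left_mass_ge0 n : 0 <= left_mass F h n.
Proof.
case: n => [|n]; rewrite subr_ge0; apply: Fnd.
  by rewrite ge0_cp// ltW.
by rewrite lerN2 ler_pM2l// ler_nat.
Qed.

Lemma le_head_of_decr_ge0 p n : (forall n, 0 <= decr p n) -> p n <= p 0%N.
Proof.
by move=> d; elim: n => // n; have := d n; rewrite /decr subr_ge0; exact: le_trans.
Qed.

Lemma right_mass_cvg0 : right_mass F h @ \oo --> (0 : R).
Proof.
rewrite -(cvg_shiftn 1); rewrite (_ : (fun n => _) = fun n =>
    F (h * (n + 2)%:R) - F (h * (n + 1)%:R)); last first.
  by apply/funext => n; rewrite addn1 addn2.
have c1 : (fun n => F (h * (n + 1)%:R)) @ \oo --> (1 : R).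
  by rewrite (cvg_shiftn 1 (fun n => F (h * n%:R))); exact: cvg_distr_right.
have c2 : (fun n => F (h * (n + 2)%:R)) @ \oo --> (1 : R).
  by rewrite (cvg_shiftn 2 (fun n => F (h * n%:R))); exact: cvg_distr_right.
by have := cvgB c2 c1; rewrite subrr; exact.
Qed.

Lemma left_mass_cvg0 : left_mass F h @ \oo --> (0 : R).
Proof.
rewrite -(cvg_shiftn 1); rewrite (_ : (fun n => _) = fun n =>
    F (- (h * (n + 1)%:R)) - F (- (h * (n + 2)%:R))); last first.
  by apply/funext => n; rewrite addn1 addn2.
have c1 : (fun n => F (- (h * (n + 1)%:R))) @ \oo --> (0 : R).
  by rewrite (cvg_shiftn 1 (fun n => F (- (h * n%:R)))); exact: cvg_distr_left.
have c2 : (fun n => F (- (h * (n + 2)%:R))) @ \oo --> (0 : R).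
  by rewrite (cvg_shiftn 2 (fun n => F (- (h * n%:R)))); exact: cvg_distr_left.
by have := cvgB c1 c2; rewrite subrr; exact.
Qed.

Hypotheses (plc : logconvex (decr (right_mass F h))) (qlc : logconvex (decr (left_mass F h))).

(** The masses decrease away from 0, so if the central one vanished there would be no mass at all. *)
Lemma central_mass_gt0 : 0 < right_mass F h 0.
Proof.
rewrite lt_def right_mass_ge0 andbT; apply/negP => /eqP p0.
have pn n : right_mass F h n = 0.
  apply/eqP; rewrite eq_le right_mass_ge0 andbT.
  by have := @le_head_of_decr_ge0 (right_mass F h) n plc.1; rewrite p0.
have qn n : left_mass F h n = 0.
  apply/eqP; rewrite eq_le left_mass_ge0 andbT.
  by have := @le_head_of_decr_ge0 (left_mass F h) n qlc.1; rewrite -[left_mass F h 0]/(right_mass F h 0) p0.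
have zero_series : series (fun=> 0 : R) @ \oo --> (0 : R).
  rewrite (_ : series _ = cst 0); first exact: cvg_cst.
  by apply/funext => n; rewrite /series/= big1.
have F1 : 1 - F (h * 1%:R) = 0.
  have := @right_mass_sum 0%N; under eq_fun do rewrite pn.
  by move=> c; exact: (cvg_unique (@Rhausdorff R) c zero_series).
have F0 : F (- (h * 1%:R)) = 0.
  have := @left_mass_sum 0%N; under eq_fun do rewrite qn.
  by move=> c; exact: (cvg_unique (@Rhausdorff R) c zero_series).
rewrite mulr1 in F0; rewrite mulr1 in F1.
move: p0; rewrite /right_mass F0 subr0 => Fh.
by move: F1 => /eqP; rewrite Fh subr0 oner_eq0.
Qed.

(** Up to a factor, the two sequences of the factorization of the rounded law are probabilities, and
the n-th roots of both combine into one of the rounded law, which at x lies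
between F (x - h) and F (x + 2 * h). *)
Theorem lattice_approximation n : exists2 K, averaging K & forall x,
  (iter n.+1 K heaviside x <= (F (x + 2 * h))%:E /\
   (F x)%:E <= iter n.+1 K heaviside (x + h)%R)%E.
Proof.
have [t [tau [[tlc taulc t0 tau0] [tp tq]]]] :=
  @wiener_hopf _ (right_mass F h) (left_mass F h) erefl central_mass_gt0 right_mass_cvg0 left_mass_cvg0 plc qlc.
have [[tge _] [tauge _]] := (tlc, taulc).
have total : (\sum_(j <oo) \sum_(k <oo) (t j * tau k)%:E = 1)%E.
  rewrite -(lattice_law_right tge tauge h0 tp 0).
  have := lattice_law_left tge tauge h0 tq 0.
  rewrite !mulr0 oppr0 => ->.
  rewrite (nneseries_EFin (fun i => right_mass_ge0 (i + 1)) (@right_mass_sum 0%N)).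
  rewrite (nneseries_split 0%N 1%N); last by move=> i _; rewrite lee_fin left_mass_ge0.
  rewrite add0n big_nat1 -nneseries_addn; last by move=> i; rewrite lee_fin left_mass_ge0.
  under eq_eseriesr do rewrite addn0.
  rewrite (nneseries_EFin (fun i => left_mass_ge0 (i + 1)) (@left_mass_sum 0%N)).
  by rewrite /= mulr1 -!EFinD; congr (_%:E); ring.
have tau_ge0 : (0 <= \sum_(k <oo) (tau k)%:E)%E.
  by apply: nneseries_ge0 => k _ _; rewrite lee_fin.
have [s s0 taus] : exists2 s : R, 0 < s & (\sum_(k <oo) (tau k)%:E = s%:E)%E.
  have : ((t 0%N)%:E * \sum_(k <oo) (tau k)%:E <= 1)%E.
    rewrite -nneseriesZl; last by move=> k _; rewrite lee_fin.
    rewrite -total.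
    have := @nneseries_lim_ge _ (fun j => \sum_(k <oo) (t j * tau k)%:E)%E xpredT 0%N 1%N.
    rewrite big_nat1 => H; apply: le_trans (H _) => [|j _ _]; last first.
      by apply: nneseries_ge0 => k _ _; rewrite lee_fin mulr_ge0.
    by rewrite le_eqVlt; apply/orP; left; apply/eqP; apply: eq_eseriesr => k _; rewrite EFinM.
  have : ((tau 0%N)%:E <= \sum_(k <oo) (tau k)%:E)%E.
    have := @nneseries_lim_ge _ (fun k => (tau k)%:E)%E xpredT 0%N 1%N.
    by rewrite big_nat1; apply => j _ _; rewrite lee_fin.
  move: tau_ge0; case: (limn _) => [s _|_ _|//].
    by rewrite lee_fin => taus _; exists s => //; exact: lt_le_trans taus.
  by rewrite gt0_muley ?lte_fin// leye_eq.
have ts : (\sum_(k <oo) (t k)%:E = (s^-1)%:E)%E.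
  have ge0 : (0 <= \sum_(k <oo) (t k)%:E)%E.
    by apply: nneseries_ge0 => k _ _; rewrite lee_fin.
  have : (s%:E * \sum_(k <oo) (t k)%:E = 1)%E.
    rewrite -nneseriesZl; last by move=> k _; rewrite lee_fin.
    rewrite -total; apply: eq_eseriesr => j _.
    under [RHS]eq_eseriesr do rewrite EFinM.
    rewrite nneseriesZl; last by move=> k _; rewrite lee_fin.
    by rewrite taus muleC.
  move: ge0; case: (limn _) => [r _|_|//].
    by rewrite -EFinM => -[] sr; rewrite -[r]mul1r -(mulVf (lt0r_neq0 s0)) -mulrA sr mulr1.
  by rewrite gt0_muley ?lte_fin.
(* The product of the total masses is 1, so this makes both sequences probabilities. *)
pose a k := s * t k; pose b k := s^-1 * tau k.
have si0 : 0 < s^-1 by rewrite invr_gt0.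
have alc : logconvex a by apply: logconvexZ => //; exact: ltW.
have blc : logconvex b by apply: logconvexZ => //; exact: ltW.
have abE j k : a j * b k = t j * tau k by rewrite /a /b mulrACA mulfV ?gt_eqF// mul1r.
have a1 : (\sum_(k <oo) (a k)%:E = 1)%E.
  under eq_eseriesr do rewrite EFinM.
  rewrite nneseriesZl; last by move=> k _; rewrite lee_fin.
  by rewrite ts -EFinM mulfV// gt_eqF.
have b1 : (\sum_(k <oo) (b k)%:E = 1)%E.
  under eq_eseriesr do rewrite EFinM.
  rewrite nneseriesZl; last by move=> k _; rewrite lee_fin.
  by rewrite taus -EFinM mulVf// gt_eqF.
have ap m : series (fun k => a (m + k)%N * b k) @ \oo --> right_mass F h m.
  by under [fun k => _]eq_fun do rewrite abE; exact: tp.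
have bq m : series (fun k => a k * b (m + k)%N) @ \oo --> left_mass F h m.
  by under [fun k => _]eq_fun do rewrite abE; exact: tq.
have [K hK KE] := two_sided_root h (- h) n alc (mulr_gt0 s0 t0) blc (mulr_gt0 si0 tau0) a1 b1.
have [[a0 _] [b0 _]] := (alc, blc).
exists K => //; set G := iter _ _ _.
have Gnd x y : x <= y -> (G x <= G y)%E.
  exact: (avg_heaviside_nondecreasing (averaging_iter n.+1 hK)).
have Gleft M : G (- (h * M.+1%:R)) = (F (- (h * M.+1%:R)))%:E.
  rewrite /G KE (lattice_law_left a0 b0 h0 bq).
  exact: (nneseries_EFin (fun i => left_mass_ge0 (i + M.+1)) (@left_mass_sum M)).
have Gright N : G (h * N%:R) = (F (h * N.+1%:R))%:E.
  have := lattice_law_right a0 b0 h0 ap N; rewrite -KE.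
  rewrite (nneseries_EFin (fun i => right_mass_ge0 (i + N.+1)) (@right_mass_sum N)).
  under [in X in _ = X -> _]eq_eseriesr do under eq_eseriesr do rewrite abE.
  rewrite total -/G; have := avg_fin n.+1 (h * N%:R) hK; rewrite -/G.
  by case: (G _) => [r _| |]//; rewrite -EFinD => -[] E; congr (_%:E); lra.
(* On the lattice the law is squeezed between F and its translate by one mesh. *)
have Gz (z : int) : ((F (h * z%:~R)%R)%:E <= G (h * z%:~R)%R /\ G (h * z%:~R)%R <= (F (h * (z + 1)%:~R)%R)%:E)%E.
  case: z => [N|M].
    rewrite [(Posz N)%:~R]/(N%:R) Gright.
    rewrite (_ : (Posz N + 1)%:~R = N.+1%:R :> R); last by rewrite intrD -natr1.
    by rewrite !lee_fin; split=> //; apply: Fnd; rewrite ler_pM2l// ler_nat.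
  rewrite NegzE [(- _)%:~R]mulrNz mulrN Gleft; split => //.
  rewrite lee_fin; apply: Fnd; rewrite -mulrN ler_pM2l//.
  by rewrite intrD mulrNz lerDl.
move=> x; pose z := Num.floor (x / h).
have [zx xz] : h * z%:~R <= x /\ x < h * (z + 1)%:~R.
  have /andP[z1 z2] := floor_itv (x / h).
  by rewrite ![h * _]mulrC -ler_pdivlMr// -ltr_pdivrMr.
have zE (y : int) : h * (y + 1)%:~R = h * y%:~R + h by rewrite intrD mulrDr mulr1.
have zh : h * (z + 1)%:~R <= x + h by rewrite zE lerD2r.
split.
  apply: (le_trans (Gnd _ _ (ltW xz))); apply: (le_trans (Gz (z + 1)).2).
  rewrite lee_fin; apply: Fnd; rewrite !zE.
  by rewrite mulr_natl mulr2n addrA !lerD2r.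
apply: le_trans (Gnd _ _ zh); apply: le_trans (Gz (z + 1)).1.
by rewrite lee_fin; apply: Fnd; exact: ltW.
Qed.

End approximation.
End lattice_law.

(** * Second differences of the distribution function *)

Section second_difference.
Context {R : realType}.

(** Lebesgue measure is characterized by its values on bounded intervals, so a map that preserves
these preserves integrals. *)
Lemma ge0_integral_isometry (phi : R -> R) (D : set R) (g : R -> R) :
  @measurable_fun _ _ (measurableTypeR R) (measurableTypeR R) setT phi ->
  (forall a b : R, lebesgue_measure (phi @^-1` `]a, b]%classic) = lebesgue_measure `]a, b]%classic) ->
  measurable D -> measurable_fun [set: R] g -> (forall x, D x -> 0 <= g x) ->
  (\int[lebesgue_measure]_(y in D) (g y)%:E =
   \int[lebesgue_measure]_(y in phi @^-1` D) (g (phi y))%:E)%E.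
Proof.
move=> mphi iso mD mg g0.
have mg' : @measurable_fun _ _ (measurableTypeR R) (\bar R) D (EFin \o g).
  apply/measurable_EFinP; apply: (@measurable_funTS _ _ (measurableTypeR R) R); exact: mg.
have g0' : {in D, forall y, (0 <= (EFin \o g) y)%E} by move=> y; rewrite inE => Dy; rewrite /= lee_fin g0.
rewrite -(@ge0_integral_pushforward _ _ (measurableTypeR R) (measurableTypeR R) R phi mphi
  lebesgue_measure D (EFin \o g) mD mg' g0').
apply: eq_measure_integral => A mA _.
pose mphi_mixin := @isMeasurableFun.Build _ _ (measurableTypeR R) (measurableTypeR R) phi mphi.
pose phi' : {mfun measurableTypeR R >-> measurableTypeR R} := HB.pack phi mphi_mixin.
apply: (@lebesgue_measure_unique R (pushforward lebesgue_measure phi')) => //.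
by move=> X [[a b] _ <-]; symmetry; exact: iso.
Qed.

Lemma ge0_integral_shift (g : R -> R) (a b c : R) :
  measurable_fun [set: R] g -> (forall x, a + c < x -> 0 <= g x) ->
  (\int[lebesgue_measure]_(y in `](a + c)%R, (b + c)%R[) (g y)%:E =
   \int[lebesgue_measure]_(y in `]a, b[) (g (y + c)%R)%:E)%E.
Proof.
move=> mg g0; rewrite (@ge0_integral_isometry (fun y => y + c))//; last 3 first.
- exact: measurable_addR.
- move=> u w; rewrite (_ : _ @^-1` _ = `]u - c, w - c]%classic); last first.
    by apply/seteqP; split => y /=; rewrite !in_itv/= ltrBlDr lerBrDr.
  rewrite !lebesgue_measure_itv/= !lte_fin ltrD2r.
  by case: ifP => // _; rewrite -!EFinB; congr (_%:E); ring.
- by move=> y /=; rewrite in_itv/= => /andP[/g0].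
congr (integral _ _ _); apply/seteqP; split => y /=; by rewrite !in_itv/= ltrD2r ltrD2r.
Qed.

Lemma ge0_integral_oppr (g : R -> R) (a b : R) :
  measurable_fun [set: R] g -> (forall x, 0 <= g x) ->
  (\int[lebesgue_measure]_(y in `](- b)%R, (- a)%R[) (g y)%:E =
   \int[lebesgue_measure]_(y in `]a, b[) (g (- y)%R)%:E)%E.
Proof.
move=> mg g0; rewrite (@ge0_integral_isometry -%R)//; last first.
  move=> u w; rewrite (_ : _ @^-1` _ = `[- w, - u[%classic); last first.
    by apply/seteqP; split => y /=; rewrite !in_itv/= ltrNr lerNl andbC.
  rewrite !lebesgue_measure_itv/= !lte_fin ltrN2.
  by case: ifP => // _; rewrite -!EFinB; congr (_%:E); ring.
congr (integral _ _ _); apply/seteqP; split => y /=; by rewrite !in_itv/= ltrN2 ltrN2 andbC.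
Qed.

(** Log-convexity is integrated in its linear form, for one value of l at a time. *)
Lemma integral_amgm (D : set R) (g0 g1 g2 : R -> R) (l i0 i1 i2 : R) :
  measurable D -> 0 < l ->
  [/\ measurable_fun [set: R] g0, measurable_fun [set: R] g1 & measurable_fun [set: R] g2] ->
  (forall x, D x -> [/\ 0 <= g0 x, 0 <= g1 x & 0 <= g2 x]) ->
  (forall x, D x -> 2 * g1 x <= l * g0 x + l^-1 * g2 x) ->
  (\int[lebesgue_measure]_(y in D) (g0 y)%:E = i0%:E)%E ->
  (\int[lebesgue_measure]_(y in D) (g1 y)%:E = i1%:E)%E ->
  (\int[lebesgue_measure]_(y in D) (g2 y)%:E = i2%:E)%E ->
  2 * i1 <= l * i0 + l^-1 * i2.
Proof.
move=> mD l0 [m0 m1 m2] gge H E0 E1 E2.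
have mE (g : R -> R) : measurable_fun [set: R] g ->
    @measurable_fun _ _ (measurableTypeR R) (\bar R) D (fun y => (g y)%:E).
  move=> mg; apply/measurable_EFinP.
  by apply: (@measurable_funTS _ _ (measurableTypeR R) R); exact: mg.
have l1 : 0 < l^-1 by rewrite invr_gt0.
have ZE (c : R) (g : R -> R) (i : R) : 0 <= c -> measurable_fun [set: R] g -> (forall x, D x -> 0 <= g x) ->
    (\int[lebesgue_measure]_(y in D) (g y)%:E = i%:E)%E ->
    (\int[lebesgue_measure]_(y in D) (c * g y)%:E = (c * i)%:E)%E.
  move=> c0 mg gx gi.
  have gx' x : D x -> (0 <= (g x)%:E)%E by move=> Dx; rewrite lee_fin gx.
  have E := @ge0_integralZl_EFin _ (measurableTypeR R) R lebesgue_measure D mD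
    (fun y => (g y)%:E) gx' (mE _ mg) c c0.
  by rewrite EFinM -gi; exact: E.
have mZ (c : R) (g : R -> R) : measurable_fun [set: R] g -> measurable_fun [set: R] (fun y => c * g y).
  by move=> mg; exact: measurable_funM.
have n0 x : D x -> 0 <= g0 x by move=> /gge[].
have n1 x : D x -> 0 <= g1 x by move=> /gge[].
have n2 x : D x -> 0 <= g2 x by move=> /gge[].
rewrite -lee_fin EFinD -(ZE _ _ _ (ler0n R 2) m1 n1 E1).
rewrite -(ZE _ _ _ (ltW l0) m0 n0 E0) -(ZE _ _ _ (ltW l1) m2 n2 E2).
have h0 (c : R) (g : R -> R) (x : R) : 0 <= c -> 0 <= g x -> (0 <= (c * g x)%:E)%E.
  by move=> c0 gx; rewrite lee_fin mulr_ge0.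
rewrite -ge0_integralD//.
- apply: ge0_le_integral => //.
  + by move=> x /gge[_ ? _]; exact: h0.
  + by apply: mE; exact: mZ.
  + by apply: emeasurable_funD; apply: mE; exact: mZ.
- by move=> x /gge[? _ _]; apply: h0 => //; exact: ltW.
- by apply: mE; exact: mZ.
- by move=> x /gge[_ _ ?]; apply: h0 => //; exact: ltW.
- by apply: mE; exact: mZ.
Qed.

Section one_sided.
Variables (f v Phi : R -> R) (h : R).
Hypotheses (h01 : 0 < h < 1) (mf : measurable_fun [set: R] f) (f0 : forall x, 0 <= f x).
Hypotheses (mv : measurable_fun (`]0, +oo[%classic : set R) v) (lcv : log_convex v).
Hypothesis fv : forall x, 0 < x -> (f x)%:E = tail_integral v x.
Hypothesis fPhi : forall a b, 0 <= a -> a <= b ->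
  (Phi b - Phi a)%:E = (\int[lebesgue_measure]_(y in `]a, b[) (f y)%:E)%E.

Let h0 : 0 < h. Proof. by case/andP: h01. Qed.

Let w : R -> R := v \_ `]0, +oo[%classic.

Let mw : measurable_fun [set: R] w.
Proof.
by apply: (measurable_restrict _ _ _).1 => //; rewrite setTI.
Qed.

Let wE y : 0 < y -> w y = v y.
Proof. by move=> y0; rewrite /w patchE mem_set//= in_itv/= y0. Qed.

Let w0 y : 0 <= w y.
Proof.
rewrite /w patchE; case: ifPn => // /set_mem /=; rewrite in_itv/= andbT.
exact: lcv.1.
Qed.

Let measurable_shift (g : R -> R) c : measurable_fun [set: R] g ->
  measurable_fun [set: R] (fun y => g (y + c)).
Proof. by move=> mg; apply: measurableT_comp => //; exact: measurable_funD. Qed.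

(** Finiteness of f turns the splitting of the tail integral into a difference. *)
Lemma tail_increment y : 0 < y ->
  (\int[lebesgue_measure]_(z in `]y, (y + h)%R[) (w z)%:E = (f y - f (y + h))%:E)%E.
Proof.
move=> y0.
have yh0 : 0 < y + h by rewrite addr_gt0.
have mw' (D : set R) : @measurable_fun _ _ (measurableTypeR R) (\bar R) D (fun z => (w z)%:E).
  by apply/measurable_EFinP; apply: (@measurable_funTS _ _ (measurableTypeR R) R); exact: mw.
have tw x : 0 < x -> (f x)%:E = (\int[lebesgue_measure]_(z in `[x, +oo[) (w z)%:E)%E.
  move=> x0; rewrite fv// /tail_integral; apply: eq_integral => z.
  by rewrite inE/= in_itv/= andbT => xz; rewrite wE// (lt_le_trans x0).
have : (f y)%:E = (\int[lebesgue_measure]_(z in `]y, (y + h)%R[) (w z)%:E + (f (y + h))%:E)%E.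
  rewrite tw// tw//.
  rewrite -(@integral_itv_bndoo R y (y + h) _ true true)//.
  rewrite -ge0_integral_setU//.
  - by congr (integral _ _ _); rewrite -itv_bndbnd_setU// bnd_simp lerDl ltW.
  - by move=> z _; rewrite lee_fin.
  - apply/disj_setPS => z [] /=; rewrite !in_itv/= andbT => /andP[_ zy] /(lt_le_trans zy).
    by rewrite ltxx.
  exact: mw'.
by rewrite [in X in _ -> X]EFinB => ->; rewrite addeK.
Qed.

Let D z := f z - f (z + h).

Let mD : measurable_fun [set: R] D.
Proof. by apply: measurable_funB => //; exact: measurable_shift. Qed.

Lemma decrement_ge0 z : 0 < z -> 0 <= D z.
Proof.
move=> z0; rewrite -lee_fin -tail_increment//; apply: integral_ge0 => y _.
by rewrite lee_fin.
Qed.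

(** f(z) - f(z + h) integrates v over an interval of length h at z, and log-convexity is integrated
for the step h, which is smaller than 1. *)
Lemma decrement_amgm z l : 0 < z -> 0 < l -> 2 * D (z + h) <= l * D z + l^-1 * D (z + 2 * h).
Proof.
move=> z0 l0.
have zh0 : 0 < z + h by rewrite addr_gt0.
have zhh0 : 0 < z + 2 * h by rewrite addr_gt0// mulr_gt0.
apply: (@integral_amgm `]z, z + h[%classic w (fun y => w (y + h)) (fun y => w (y + 2 * h))) => //.
- by split => //; exact: measurable_shift.
- move=> y /=; rewrite in_itv/= => /andP[zy _].
  have y0 : 0 < y := lt_trans z0 zy.
  have yh0 : 0 < y + h by rewrite addr_gt0.
  have yhh0 : 0 < y + 2 * h by rewrite addr_gt0// mulr_gt0.
  rewrite !wE//; apply: (sqr_le_mul_amgm _ _ _).1 => //; try exact: lcv.1.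
  exact: lcv.2.
- exact: tail_increment.
- by rewrite -ge0_integral_shift// tail_increment.
- rewrite -ge0_integral_shift// (_ : z + h + 2 * h = z + 2 * h + h) ?tail_increment//.
  by rewrite addrAC.
Qed.

Let W x := 2 * Phi (x + h) - Phi x - Phi (x + 2 * h).

Lemma second_difference_integral x : 0 <= x ->
  (\int[lebesgue_measure]_(z in `]x, (x + h)%R[) (D z)%:E = (W x)%:E)%E.
Proof.
move=> x0.
have mE (g : R -> R) (E : set R) : measurable_fun [set: R] g ->
    @measurable_fun _ _ (measurableTypeR R) (\bar R) E (fun y => (g y)%:E).
  move=> mg; apply/measurable_EFinP.
  by apply: (@measurable_funTS _ _ (measurableTypeR R) R); exact: mg.
have e1 : (Phi (x + h) - Phi x)%:E =
    (\int[lebesgue_measure]_(z in `]x, (x + h)%R[) (f z)%:E)%E.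
  by apply: fPhi => //; rewrite lerDl ltW.
have e2 : (Phi (x + 2 * h) - Phi (x + h))%:E =
    (\int[lebesgue_measure]_(z in `]x, (x + h)%R[) (f (z + h))%:E)%E.
  rewrite -ge0_integral_shift// fPhi ?addr_ge0 ?(ltW h0)//.
    by rewrite (_ : x + 2 * h = x + h + h)//; ring.
  by rewrite lerD2l; apply: ler_peMl; [exact: ltW|rewrite ler1n].
have : ((Phi (x + h) - Phi x)%:E =
    \int[lebesgue_measure]_(z in `]x, (x + h)%R[) (D z)%:E + (Phi (x + 2 * h) - Phi (x + h))%:E)%E.
  rewrite e1 e2 -ge0_integralD//.
  - by apply: eq_integral => z _; rewrite -EFinD subrK.
  - move=> z /=; rewrite in_itv/= => /andP[xz _]; rewrite lee_fin decrement_ge0//.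
    exact: le_lt_trans xz.
  - exact: mE.
  - by move=> z _; rewrite lee_fin.
  - by apply: mE; exact: measurable_shift.
move=> /(congr1 (fun z => (z - (Phi (x + 2 * h) - Phi (x + h))%:E)%E)).
rewrite addeK// => <-; rewrite -EFinB.
by congr (_%:E); rewrite /W; ring.
Qed.

(** The second difference integrates the decrements of f over an interval of length h, so the linear
form of log-convexity is integrated a second time. *)
Lemma second_difference_logconvex : logconvex (fun n => W (h * n%:R)).
Proof.
have W0 x : 0 <= x -> 0 <= W x.
  move=> x0; rewrite -lee_fin -second_difference_integral//; apply: integral_ge0 => z /=.
  rewrite in_itv/= => /andP[xz _]; rewrite lee_fin decrement_ge0//; exact: le_lt_trans xz.
have hn0 n : 0 <= h * n%:R by rewrite mulr_ge0// ltW.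
apply/logconvexP; split=> [n|l n l0]; first exact: W0.
set x := h * n%:R.
have x0 : 0 <= x by exact: hn0.
have -> : h * n.+1%:R = x + h by rewrite -natr1 mulrDr mulr1.
have -> : h * n.+2%:R = x + 2 * h by rewrite -[n.+2%:R]natr1 -natr1 /x; ring.
have xz z : `]x, x + h[%classic z -> 0 < z.
  by rewrite /= in_itv/= => /andP[xz _]; exact: le_lt_trans xz.
apply: (@integral_amgm `]x, x + h[%classic D (fun y => D (y + h)) (fun y => D (y + 2 * h))) => //.
- by split => //; exact: measurable_shift.
- move=> z /xz z0; split; apply: decrement_ge0 => //; first by rewrite addr_gt0.
  by rewrite addr_gt0// mulr_gt0.
- by move=> z /xz z0; exact: decrement_amgm.
- exact: second_difference_integral.
- rewrite -ge0_integral_shift//; last first.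
    by move=> z xhz; apply: decrement_ge0; rewrite (lt_trans _ xhz)// ltr_wpDl.
  by rewrite second_difference_integral// addr_ge0// ltW.
- rewrite -ge0_integral_shift//; last first.
    by move=> z xhz; apply: decrement_ge0; rewrite (lt_trans _ xhz)// ltr_wpDl// mulr_gt0.
  rewrite (_ : x + h + 2 * h = x + 2 * h + h); last by rewrite addrAC.
  by rewrite second_difference_integral// addr_ge0// mulr_ge0// ltW.
Qed.

End one_sided.
End second_difference.

(** * The mixture *)

Section assembly.
Context {R : realType}.

(** The head of the sequence occurs only on the larger side of the inequality. *)
Lemma logconvex_raise0 (s : nat -> R) c : 0 <= c -> logconvex s ->
  logconvex (fun n => s n + (n == 0%N)%:R * c).
Proof.
move=> c0 [s0 Hs]; split=> n; first by rewrite addr_ge0// mulr_ge0.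
rewrite /= !mul0r !addr0; apply: le_trans (Hs n) _.
by rewrite ler_wpM2r// lerDl mulr_ge0.
Qed.

Lemma point_mass_distributionE (F1 : R -> R) : is_distribution_function_of \d_(0 : R) F1 ->
  forall x, F1 x = (0 <= x)%R%:R.
Proof.
move=> hF1 x; have := hF1 x; rewrite diracE mem_setE in_itv/= => -[->].
by [].
Qed.

Lemma mixture_distribution alpha (F1 F2 : distribution_function R) :
  0 <= alpha <= 1 -> exists F : distribution_function R, mixture alpha F1 F2 =1 F.
Proof.
move=> /andP[a0 a1]; apply: ex_distribution_function.
- move=> x y xy; rewrite /mixture; apply: lerD.
    by rewrite ler_wpM2l//; exact: (cumulative_is_nondecreasing F1).
  by rewrite ler_wpM2l ?subr_ge0//; exact: (cumulative_is_nondecreasing F2).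
- move=> x; apply: cvgD; apply: cvgMl_tmp; exact: cumulative_is_right_continuous.
- have c : (fun x => alpha * F1 x + (1 - alpha) * F2 x) @ -oo --> alpha * 0 + (1 - alpha) * 0.
    by apply: cvgD; apply: cvgMl_tmp; exact: cumulativeNy.
  by rewrite !mulr0 addr0 in c; exact: c.
- have c : (fun x => alpha * F1 x + (1 - alpha) * F2 x) @ +oo --> alpha * 1 + (1 - alpha) * 1.
    by apply: cvgD; apply: cvgMl_tmp; exact: cumulativey.
  have e : alpha * 1 + (1 - alpha) * 1 = 1 by ring.
  by rewrite e in c; exact: c.
Qed.

Lemma density_increment (F : distribution_function R) (f : R -> R) a b :
  is_density F f -> a <= b ->
  (F b - F a)%:E = (\int[lebesgue_measure]_(y in `]a, b[) (f y)%:E)%E.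
Proof.
move=> [mf f0 Ff] ab.
have mE (D : set R) : @measurable_fun _ _ (measurableTypeR R) (\bar R) D (fun y => (f y)%:E).
  by apply/measurable_EFinP; apply: (@measurable_funTS _ _ (measurableTypeR R) R); exact: mf.
have E : (F b)%:E = ((F a)%:E + \int[lebesgue_measure]_(y in `]a, b[) (f y)%:E)%E.
  rewrite !Ff -(@integral_itv_bndoo R a b _ false false)//; last exact: mE.
  rewrite -ge0_integral_setU//.
  - by congr (integral _ _ _); rewrite -itv_bndbnd_setU// bnd_simp.
  - by move=> z _; rewrite lee_fin.
  - apply/disj_setPS => z [] /=; rewrite !in_itv/= => za /andP[/(le_lt_trans za)].
    by rewrite ltxx.
by rewrite EFinB E addeAC subee// add0e.
Qed.

End assembly.

Theorem corollary3p3 (R : realType)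
  (F1 F2 : distribution_function R) (f2 v1 v2 : R -> R)
  (hF1 : is_distribution_function_of \d_(0 : R) F1)
  (hF2 : is_density F2 f2)
  (mv1 : measurable_fun (`]0, +oo[%classic : set R) v1)
  (mv2 : measurable_fun (`]0, +oo[%classic : set R) v2)
  (hv1 : log_convex v1)
  (hv2 : log_convex v2)
  (hneg : forall x : R, x < 0 -> (f2 x)%:E = tail_integral v1 `|x|)
  (hpos : forall x : R, 0 < x -> (f2 x)%:E = tail_integral v2 x)
  (alpha : R) (halpha : 0 <= alpha <= 1) :
  infinitely_divisible (mixture alpha F1 F2).
Proof.
have [F FE] := mixture_distribution F1 F2 halpha.
have [a0 a1] : 0 <= alpha /\ 0 <= 1 - alpha by case/andP: halpha; rewrite subr_ge0.
have [mf f0 _] := hF2.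
have F1E := point_mass_distributionE hF1.
have Fpos x : 0 <= x -> F x = alpha + (1 - alpha) * F2 x.
  by move=> x0; rewrite -FE /mixture F1E x0 mulr1.
have Fneg x : x < 0 -> F x = (1 - alpha) * F2 x.
  by move=> x0; rewrite -FE /mixture F1E leNgt x0 mulr0 add0r.
have F2nd x y : x <= y -> F2 x <= F2 y by exact: (cumulative_is_nondecreasing F2).
have Fnd x y : x <= y -> F x <= F y by exact: (cumulative_is_nondecreasing F).
have right_lc h : 0 < h < 1 -> logconvex (decr (right_mass F h)).
  move=> h01; have [h0 h1] := andP h01.
  have lc := @second_difference_logconvex R f2 v2 F2 h h01 mf f0 mv2 hv2 hpos
    (fun a b _ ab => density_increment hF2 ab).
  have c0 : 0 <= alpha + (1 - alpha) * (F2 0 - F2 (- h)).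
    by rewrite addr_ge0// mulr_ge0// subr_ge0 F2nd// oppr_le0 ltW.
  have := logconvex_raise0 c0 (logconvexZ a1 lc).
  congr logconvex; apply/funext => -[|n]; rewrite /decr /right_mass.
    rewrite eqxx mul1r !mulr0 !add0r !mulr1 (Fpos h) ?ltW// (Fneg (- h)) ?oppr_lt0//.
    by rewrite (Fpos (h * 2)) ?mulr_ge0 ?ltW// [2 * h]mulrC; ring.
  have hn0 (k : nat) : 0 <= h * k%:R by rewrite mulr_ge0// ltW.
  rewrite !Fpos//.
  have -> : h * n.+2%:R = h * n.+1%:R + h by rewrite -[n.+2%:R]natr1; ring.
  have -> : h * n.+3%:R = h * n.+1%:R + 2 * h by rewrite -[n.+3%:R]natr1 -[n.+2%:R]natr1; ring.
  by rewrite /=; ring.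
have left_lc h : 0 < h < 1 -> logconvex (decr (left_mass F h)).
  move=> h01; have [h0 h1] := andP h01.
  have mf' : measurable_fun [set: R] (fun x => f2 (- x)).
    by apply: measurableT_comp => //; exact: oppr_measurable.
  have hneg' x : 0 < x -> (f2 (- x))%:E = tail_integral v1 x.
    by move=> x0; rewrite hneg ?oppr_lt0// normrN gtr0_norm.
  have incr a b : 0 <= a -> a <= b ->
      (- F2 (- b) - - F2 (- a))%:E = (\int[lebesgue_measure]_(y in `]a, b[) (f2 (- y))%:E)%E.
    move=> _ ab; rewrite -ge0_integral_oppr//.
    by rewrite -(density_increment hF2) ?lerN2// opprK addrC.
  have lc := @second_difference_logconvex R (fun x => f2 (- x)) v1 (fun x => - F2 (- x)) h h01 mf'
    (fun x => f0 (- x)) mv1 hv1 hneg' incr.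
  have c0 : 0 <= alpha + (1 - alpha) * (F2 h - F2 0).
    by rewrite addr_ge0// mulr_ge0// subr_ge0 F2nd// ltW.
  have := logconvex_raise0 c0 (logconvexZ a1 lc).
  congr logconvex; apply/funext => -[|n]; rewrite /decr /left_mass.
    rewrite eqxx mul1r !mulr0 !add0r !mulr1 (Fpos h) ?ltW// (Fneg (- h)) ?oppr_lt0//.
    by rewrite (Fneg (- (h * 2))) ?oppr_lt0 ?mulr_gt0// [2 * h]mulrC oppr0; ring.
  have hn0 (k : nat) : - (h * k.+1%:R) < 0 by rewrite oppr_lt0 mulr_gt0.
  rewrite !Fneg//.
  have -> : h * n.+2%:R = h * n.+1%:R + h by rewrite -[n.+2%:R]natr1; ring.
  have -> : h * n.+3%:R = h * n.+1%:R + 2 * h by rewrite -[n.+3%:R]natr1 -[n.+2%:R]natr1; ring.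
  by rewrite /=; ring.
move=> [//|n] _.
have [|H HF] := @levy_limit R F n; last by exists H => x; rewrite HF FE.
move=> e e0.
(* Log-convexity of v1 and v2 is available for steps smaller than 1. *)
pose h := Num.min (e / 2) (1 / 2).
have h0 : 0 < h by rewrite lt_min !divr_gt0.
have h1 : h < 1 by rewrite (@le_lt_trans _ _ (1 / 2)) ?ge_min ?lexx ?orbT//; lra.
have he : 2 * h <= e.
  have : h <= e / 2 by rewrite ge_min lexx.
  by lra.
have h01 : 0 < h < 1 by rewrite h0.
have [K hK KF] := lattice_approximation h0 (right_lc h h01) (left_lc h h01) n.
exists K => // x; have [KF1 KF2] := KF x; split.
  apply: (le_trans KF1); rewrite lee_fin.
  have : F (x + 2 * h) <= F (x + e) by apply: Fnd; rewrite lerD2l.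
  by lra.
apply: (le_trans KF2); apply: (@le_trans _ _ (iter n.+1 K heaviside (x + e))).
  apply: (avg_heaviside_nondecreasing (averaging_iter n.+1 hK)).
  by rewrite lerD2l; lra.
by rewrite leeDl// lee_fin ltW.
Qed.
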